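(* For all integers $d,k\ge 2$, the Neretin group $\mathcal N_{d,k}$ is not a type I group.
   Context: Neretin groups. Let $d,k\ge 2$ be integers and let $\mathcal T_{d,k}$ be the rooted tree in which the root has $k$ descendants and every other vertex has $d$ descendants. An almost automorphism of $\mathcal T_{d,k}$ is a triple $(A,B,\varphi)$ where $A,B$ are finite subtrees of $\mathcal T_{d,k}$ containing the root with $|\partial A|=|\partial B|$ (here $\partial A$ may be taken to be the set of vertices outside $A$ adjacent to $A$, i.e. the complements $\mathcal T_{d,k}\setminus A$ and $\mathcal T_{d,k}\setminus B$ have the same number of connected components) and $\varphi:\mathcal T_{d,k}\setminus A\to\mathcal T_{d,k}\setminus B$ is an isomorphism of forests. Two triples $(A,B,\varphi)$, $(A',B',\varphi')$ are identified if there is a finite subtree $A''\supseteq A\cup A'$ such that $\varphi$ and $\varphi'$ coincide on $\mathcal T_{d,k}\setminus A''$. The set of equivalence classes is a group $\mathcal N_{d,k}$ under composition, the Neretin group; it acts faithfully by homeomorphisms on the space of ends $\partial\mathcal T_{d,k}$. It carries a unique locally compact group topology for which the inclusion of the profinite group $\mathrm{Aut}(\mathcal T_{d,k})$ (automorphisms of the rooted tree) is continuous and open; it is always endowed with this topology. A locally compact group $G$ is of type I if for every (continuous) unitary representation $\pi$ of $G$, the von Neumann algebra $\pi(G)''$ is of type I. *)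

(* Defs.v *)
From HB Require Import structures.
From mathcomp Require Import all_boot all_algebra finmap complex zify.
From mathcomp Require Import all_classical all_reals all_analysis.

Set Implicit Arguments.
Unset Strict Implicit.
Unset Printing Implicit Defensive.

Import GRing.Theory Num.Theory numFieldNormedType.Exports.
Local Open Scope classical_set_scope.

HB.mixin Record isTopologicalGroup G & Group G & Topological G := {
  mulg_continuous : continuous (fun xy : G * G => (xy.1 * xy.2)%g);
  invg_continuous : continuous (fun x : G => x^-1)%g
}.

#[short(type="topologicalGroupType")]
HB.structure Definition TopologicalGroup :=
  {G of Group G & Topological G & isTopologicalGroup G}.



(* None is the root of T_{d,k}; Some (i, s) is the vertex reached from the root
   through its child i and then through the letters of s, read from right to
   left, so that the last letter is at the head.  Hence the root has k children
   and any other vertex has d children. *)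
Definition vertex (d k : nat) : Type := option ('I_k * seq 'I_d).
HB.instance Definition _ d k := Countable.on (vertex d k).
HB.instance Definition _ d k := hasNbhs.Build (vertex d k) principal_filter.
HB.instance Definition _ d k := Discrete_ofNbhs.Build (vertex d k) erefl.

Section tree.
Variables d k : nat.
Local Notation V := (vertex d k).
Implicit Types (u v w : V) (A B C D : set V).

Definition root : V := None.

(* The value at the root is a dummy one. *)
Definition parent v : V := if v is Some (i, _ :: s) then Some (i, s) else None.

Definition child_of u v := (v != root) && (parent v == u).

Definition adjacent : rel V := fun u v => child_of u v || child_of v u.

(* A set containing the root spans a connected subgraph iff each of its elements
   is joined to the root inside it. *)
Definition finite_subtree A := [/\ finite_set A, A root &
  forall v, A v -> exists p : seq V,
    [/\ path adjacent root p, last root p = v & forall u, u \in p -> A u]].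

Definition boundary A : set V :=
  [set v | ~ A v /\ exists2 u, A u & adjacent u v].

Definition depth v := if v is Some (_, s) then (size s).+1 else 0.

Lemma parent_root : parent root = root. Proof. by []. Qed.

Lemma depth_parent v : v != root -> depth v = (depth (parent v)).+1.
Proof. by case: v => [[i [|j s]]|]. Qed.

Lemma finite_subtreeP A : finite_subtree A <->
  [/\ finite_set A, A root & forall v, A v -> A (parent v)].
Proof.
split=> -[finA A0 Ap]; split=> //.
  have anc p : path adjacent root p -> forall n,
      iter n parent (last root p) \in root :: p.
    elim/last_ind: p => [_ n|p x IH].
      by rewrite (_ : iter _ _ _ = root) ?mem_head//; elim: n => //= n ->.
    rewrite rcons_path last_rcons => /andP[/IH {}IH /orP[]] /andP[_ /eqP e].
      case=> [|n]; first by rewrite inE mem_rcons mem_head orbT.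
      rewrite iterSr e.
      by move: (IH n); rewrite !inE mem_rcons inE => /orP[]->; rewrite ?orbT.
    move=> n; rewrite -e -iterSr.
    by move: (IH n.+1); rewrite !inE mem_rcons inE => /orP[]->; rewrite ?orbT.
  move=> v Av; have [p [pp <- pA]] := Ap v Av.
  have := anc p pp 1%N; rewrite inE /= => /orP[/eqP ->//|]; exact: pA.
move=> v; have [n] := ubnP (depth v); elim: n v => // n IH v.
have [->|v0] := eqVneq v root; first by move=> _ _; exists [::].
rewrite ltnS depth_parent// => vn Av.
have [p [pp lp pA]] := IH _ vn (Ap _ Av).
exists (rcons p v); split; last 1 first.
- by move=> u; rewrite mem_rcons inE => /orP[/eqP ->//|]; exact: pA.
- by rewrite rcons_path pp lp /adjacent /child_of v0 eqxx.
- by rewrite last_rcons.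
Qed.

Lemma finite_subtreeU A B :
  finite_subtree A -> finite_subtree B -> finite_subtree (A `|` B).
Proof.
move=> /finite_subtreeP[fA A0 Ap] /finite_subtreeP[fB B0 Bp].
apply/finite_subtreeP; split; [by rewrite finite_setU|by left|].
by move=> v [/Ap|/Bp]; [left|right].
Qed.

Lemma boundaryE A : finite_subtree A ->
  boundary A = [set v | ~ A v /\ A (parent v)].
Proof.
move=> /finite_subtreeP[_ A0 Ap]; apply/seteqP; split=> v /= [nAv].
  move=> [u Au /orP[/andP[_ /eqP->//]|/andP[_ /eqP e]]].
  by case: nAv; rewrite -e; exact: Ap.
move=> Av; split=> //; exists (parent v) => //.
rewrite /adjacent /child_of eqxx andbT; apply/orP; left.
by apply/eqP => v0; apply: nAv; rewrite v0.
Qed.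

(* Only the restriction of aa_fun to the complement of aa_dom is meaningful:
   the values on aa_dom are ignored by the equivalence aa_equiv below. *)
Record almost_aut := AlmostAut {
  aa_dom : set V;
  aa_cod : set V;
  aa_fun :> V -> V;
  aa_dom_subtree : finite_subtree aa_dom;
  aa_cod_subtree : finite_subtree aa_cod;
  aa_boundary : (boundary aa_dom #= boundary aa_cod)%card;
  aa_bij : set_bij (~` aa_dom) (~` aa_cod) aa_fun;
  aa_adjacent : forall u v, ~ aa_dom u -> ~ aa_dom v ->
    adjacent (aa_fun u) (aa_fun v) = adjacent u v
}.

(* Isomorphisms of forests automatically preserve the parent relation, by a count
   of neighbours (see parent_isoP). *)
Definition parent_iso A B (f : V -> V) := forall v, ~ A v ->
  A (parent v) /\ B (parent (f v)) \/
  ~ A (parent v) /\ parent (f v) = f (parent v).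

Let ext v (j : 'I_d) : V := if v is Some (i, s) then Some (i, j :: s) else None.

Lemma boundary_iso A B f : finite_subtree A -> finite_subtree B ->
  set_bij (~` A) (~` B) f ->
  (forall u v, ~ A u -> ~ A v -> adjacent (f u) (f v) = adjacent u v) ->
  forall v, ~ A v -> A (parent v) -> B (parent (f v)).
Proof.
move=> /finite_subtreeP[_ A0 Ap] /finite_subtreeP[_ B0 Bp] [fAB finj fsurj] fadj.
move=> v nAv Apv; apply: contrapT => nBp.
have nBfv : ~ B (f v) by exact: fAB.
have fv0 : f v != root by apply/eqP => e; apply: nBfv; rewrite e.
have parext w j : w != root -> parent (ext w j) = w by case: w => [[]|].
have ext0 w j : w != root -> ext w j != root by case: w => [[]|].
pose h o := if o is Some j then ext (f v) j else parent (f v).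
have depth_h o : depth (h o) = if o is Some _ then (depth (f v)).+1 else (depth (f v)).-1.
  case: o => [j|] /=; last by rewrite (depth_parent fv0).
  by rewrite depth_parent ?ext0// parext.
have hinj : injective h.
  move=> o o' e; have := depth_h o; rewrite e depth_h.
  case: o o' e => [j|] [j'|]//=; try by move=> _; lia.
  by move: fv0; case: (f v) => [[i s]|//] _ [->].
have nBh o : ~ B (h o).
  by case: o => [j|//] /Bp; rewrite parext.
have adjh o : adjacent (f v) (h o).
  case: o => [j|] /=; rewrite /adjacent /child_of ?ext0// ?parext// ?eqxx//.
  by rewrite fv0 orbT.
have /boolp.choice[c cP] : forall o : option 'I_d, exists j, f (ext v j) = h o.
  move=> o.
  have [x /= nAx fx] := fsurj _ (nBh o).
  have := adjh o; rewrite -fx fadj// => /orP[/andP[x0 /eqP e]|/andP[_ /eqP e]].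
    move: x0 e fx; case: x {nAx} => [[i [|j s]]|]//= _ e fx.
      by case: nAv; rewrite -e.
    by exists j; rewrite -e /= fx.
  by case: nAx; rewrite -e.
have cinj : injective c.
  by move=> o o' e; apply: hinj; rewrite -!cP e.
by have := leq_card _ cinj; rewrite card_option !card_ord ltnn.
Qed.

Definition finv A (f : V -> V) y : V := xget root [set x | ~ A x /\ f x = y].

Lemma finvP A B f y : set_bij (~` A) (~` B) f -> ~ B y ->
  ~ A (finv A f y) /\ f (finv A f y) = y.
Proof.
move=> [_ _ fs] nBy; rewrite /finv; case: xgetP => [x ->//|/(_ _)].
by have [x nAx <-] := fs _ nBy => /(_ x); case.
Qed.

Lemma finvK A B f x : set_bij (~` A) (~` B) f -> ~ A x -> finv A f (f x) = x.
Proof.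
move=> fb nAx; have [fAB finj _] := fb.
have [? e] := finvP fb (fAB _ nAx).
by apply: finj => //; exact/mem_set.
Qed.

Lemma finv_bij A B f : set_bij (~` A) (~` B) f -> set_bij (~` B) (~` A) (finv A f).
Proof.
move=> fb; have [fAB finj fs] := fb; split.
- by move=> y /(finvP fb)[].
- move=> y y' /set_mem nBy /set_mem nBy' e.
  by have [_ <-] := finvP fb nBy; have [_ <-] := finvP fb nBy'; rewrite e.
- by move=> x nAx; exists (f x); [exact: fAB|exact: (finvK fb)].
Qed.

Lemma parent_isoP A B f : finite_subtree A -> finite_subtree B ->
  set_bij (~` A) (~` B) f ->
  (forall u v, ~ A u -> ~ A v -> adjacent (f u) (f v) = adjacent u v) <->
  parent_iso A B f.
Proof.
move=> tA tB fb; have [fAB finj fs] := fb.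
have /finite_subtreeP[_ A0 Ap] := tA; have /finite_subtreeP[_ B0 Bp] := tB.
have finj' u v : ~ A u -> ~ A v -> f u = f v -> u = v.
  by move=> nu nv; apply: finj; exact/mem_set.
have neq0 v : ~ A v -> v != root by move=> nAv; apply/eqP => e; apply: nAv; rewrite e.
have fneq0 v : ~ A v -> f v != root.
  by move=> /fAB nBv; apply/eqP => e; apply: nBv; rewrite e.
split=> [fadj v|fp u v nu nv].
  have bf := boundary_iso tA tB fb fadj.
  have [n] := ubnP (depth v); elim: n v => // n IH v; rewrite ltnS => vn nAv.
  have [Apv|nApv] := pselect (A (parent v)); first by left; split => //; exact: bf.
  right; split => //.
  have : adjacent (f (parent v)) (f v).
    by rewrite fadj// /adjacent /child_of eqxx neq0.
  move=> /orP[/andP[_ /eqP]//|/andP[_ /eqP e]].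
  have := depth_parent (neq0 _ nAv) => dv.
  have [] := IH (parent v); [by rewrite -dv|by []|by rewrite e => -[_ /fAB]|].
  rewrite e => -[nApp] /finj' -/(_ nAv nApp) ev.
  by have := depth_parent (neq0 _ nApv); rewrite -ev; lia.
have ch u' v' : ~ A u' -> ~ A v' -> child_of (f u') (f v') = child_of u' v'.
  move=> nu' nv'; rewrite /child_of fneq0// neq0//=.
  have [[Apv Bp']|[nApv e]] := fp _ nv'.
    apply/eqP/eqP => e; exfalso.
      by apply: (fAB _ nu'); rewrite -e.
    by apply: nu'; rewrite -e.
  by rewrite e; apply/eqP/eqP => [/finj'->//|->].
by rewrite /adjacent !ch.
Qed.

Lemma parent_iso_boundary A B f : finite_subtree A -> finite_subtree B ->
  set_bij (~` A) (~` B) f -> parent_iso A B f ->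
  (boundary A #= boundary B)%card.
Proof.
move=> tA tB fb fp; have [fAB finj fs] := fb.
have /finite_subtreeP[_ B0 Bp] := tB.
rewrite !boundaryE//; apply/card_set_bijP; exists f; split.
- move=> v [nAv Apv]; split; first exact: fAB.
  by have [[]|[]] := fp v nAv.
- by move=> u v /set_mem[nu _] /set_mem[nv _]; apply: finj; exact/mem_set.
- move=> y [nBy Bpy]; have [x nAx xy] := fs _ nBy; exists x => //; split => //.
  have [[]//|[nApx e]] := fp x nAx.
  by case: (fAB _ nApx); rewrite -e xy.
Qed.

Definition mk_aa A B f (tA : finite_subtree A) (tB : finite_subtree B)
    (fb : set_bij (~` A) (~` B) f) (fp : parent_iso A B f) : almost_aut :=
  AlmostAut tA tB (parent_iso_boundary tA tB fb fp) fb
    ((parent_isoP tA tB fb).2 fp).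

Lemma aa_parent (f : almost_aut) : parent_iso (aa_dom f) (aa_cod f) f.
Proof.
exact: (parent_isoP (aa_dom_subtree f) (aa_cod_subtree f) (aa_bij f)).1
  (aa_adjacent (a:=f)).
Qed.

End tree.


HB.instance Definition _ d k := gen_eqMixin (almost_aut d k).
HB.instance Definition _ d k := gen_choiceMixin (almost_aut d k).

Section neretin.
Variables d k : nat.
Local Notation V := (vertex d k).
Local Notation AA := (almost_aut d k).
Local Notation root := (@root d k).
Implicit Types (u v w : V) (A B C D : set V) (f g h : AA).

Lemma aa_inj f u v : ~ aa_dom f u -> ~ aa_dom f v -> f u = f v -> u = v.
Proof. by have [_ + _] := aa_bij f => fi nu nv; apply: fi; exact/mem_set. Qed.

Lemma aa_notin_cod f v : ~ aa_dom f v -> ~ aa_cod f (f v).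
Proof. by have [+ _ _] := aa_bij f; exact. Qed.

Lemma aa_surj f w : ~ aa_cod f w -> exists2 v, ~ aa_dom f v & f v = w.
Proof. by have [_ _ +] := aa_bij f; exact. Qed.

Lemma finite_aa_preim f C : finite_set C ->
  finite_set [set v | ~ aa_dom f v /\ C (f v)].
Proof.
move=> fC.
rewrite (_ : [set v | _] = (~` aa_dom f) `&` f @^-1` C)//.
apply: (@sub_finite_set _ _ (finv (aa_dom f) f @` C)).
  by move=> v [nv Cfv]; exists (f v) => //; exact: (finvK (aa_bij f)).
exact: finite_image.
Qed.

Definition aa_equiv f g : Prop := exists C : set V,
  [/\ finite_subtree C, aa_dom f `|` aa_dom g `<=` C &
      forall v, ~ C v -> f v = g v].

Lemma aa_equiv_eq f g : aa_fun f =1 g -> aa_equiv f g.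
Proof.
move=> fg; exists (aa_dom f `|` aa_dom g); split => //.
exact: finite_subtreeU (aa_dom_subtree f) (aa_dom_subtree g).
Qed.

Lemma aa_equiv_refl f : aa_equiv f f. Proof. exact: aa_equiv_eq. Qed.

Lemma aa_equiv_sym f g : aa_equiv f g -> aa_equiv g f.
Proof.
by move=> [C [tC sC fg]]; exists C; split => // [|v /fg//]; rewrite setUC.
Qed.

Lemma aa_equiv_trans f g h : aa_equiv f g -> aa_equiv g h -> aa_equiv f h.
Proof.
move=> [C [tC sC fg]] [D [tD sD gh]]; exists (C `|` D); split.
- exact: finite_subtreeU.
- by move=> v [?|?]; [left; apply: sC; left|right; apply: sD; right].
- by move=> v /not_orP[nC nD]; rewrite fg// gh.
Qed.

Definition aa_equivb : rel AA := fun f g => `[< aa_equiv f g >].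

Lemma aa_equivb_refl : reflexive aa_equivb.
Proof. by move=> f; exact/asboolP/aa_equiv_refl. Qed.

Lemma aa_equivb_sym : symmetric aa_equivb.
Proof.
by move=> f g; apply/asboolP/asboolP => /aa_equiv_sym.
Qed.

Lemma aa_equivb_trans : transitive aa_equivb.
Proof.
by move=> g f h /asboolP fg /asboolP gh; apply/asboolP; exact: aa_equiv_trans gh.
Qed.

Canonical aa_equiv_rel :=
  EquivRel aa_equivb aa_equivb_refl aa_equivb_sym aa_equivb_trans.

Lemma finite_subtree_root : finite_subtree [set root].
Proof.
by apply/finite_subtreeP; split => // v ->.
Qed.

Definition aa_one : AA.
Proof.
apply: (@mk_aa _ _ [set root] [set root] id); try exact: finite_subtree_root.
- by split => // y ny; exists y.
- by move=> v _; have [e|e] := pselect ([set root] (parent v)); [left|right].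
Defined.

Section comp.
Variables f g : AA.

Definition comp_dom : set V :=
  [set v | aa_dom g v \/ ~ aa_dom g v /\ aa_dom f (g v)].
Definition comp_cod : set V :=
  aa_cod f `|` f @` (aa_cod g `\` aa_dom f).

Lemma comp_domN v : ~ comp_dom v -> ~ aa_dom g v /\ ~ aa_dom f (g v).
Proof.
move=> /not_orP[nv /not_andP[//|nfv]]; split => //.
Qed.

Lemma comp_dom_subtree : finite_subtree comp_dom.
Proof.
have /finite_subtreeP[ff f0 fp] := aa_dom_subtree f.
have /finite_subtreeP[fg g0 gp] := aa_dom_subtree g.
apply/finite_subtreeP; split.
- rewrite (_ : comp_dom = aa_dom g `|` [set v | ~ aa_dom g v /\ aa_dom f (g v)])//.
  by rewrite finite_setU; split => //; exact: finite_aa_preim.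
- by left.
- move=> v [/gp|[nv fv]]; first by left.
  have [[]|[ngp e]] := aa_parent nv; first by left.
  by right; split => //; rewrite -e; exact: fp.
Qed.

Lemma comp_cod_subtree : finite_subtree comp_cod.
Proof.
have /finite_subtreeP[ff f0 fp] := aa_cod_subtree f.
have /finite_subtreeP[fg g0 gp] := aa_cod_subtree g.
apply/finite_subtreeP; split.
- by rewrite finite_setU; split => //; apply: finite_image; exact: finite_setD.
- by left.
- move=> w [/fp|[v [gv nfv] <-]]; first by left.
  have [[_]|[ngp ->]] := aa_parent nfv; first by left.
  by right; exists (parent v) => //; split => //; exact: gp.
Qed.

Lemma comp_bij : set_bij (~` comp_dom) (~` comp_cod) (f \o g).
Proof.
split.
- move=> v /comp_domN[ngv nfv] /= [|[u [gu nfu]] /(aa_inj nfu nfv) e].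
    exact: aa_notin_cod.
  by apply: (aa_notin_cod ngv); rewrite -e.
- move=> u v /set_mem/comp_domN[ngu nfu] /set_mem/comp_domN[ngv nfv] /=.
  by move=> /(aa_inj nfu nfv) /(aa_inj ngu ngv).
- move=> w /not_orP[/aa_surj[v nfv <-] nw].
  have ngv : ~ aa_cod g v by move=> gv; apply: nw; exists v.
  have [u ngu uv] := aa_surj ngv; exists u; last by rewrite /= uv.
  by move=> [//|[_]]; rewrite uv.
Qed.

Lemma comp_parent : parent_iso comp_dom comp_cod (f \o g).
Proof.
move=> v /comp_domN[ngv nfv] /=.
have [[gpv gpgv]|[ngpv e]] := aa_parent ngv.
  left; split; first by left.
  have [[_ ?]|[nfp ->]] := aa_parent nfv; first by left.
  by right; exists (parent (g v)).
have [[fp fpp]|[nfp e']] := aa_parent nfv.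
  by left; split; [right; rewrite -e|left].
by right; rewrite e' e; split => // -[//|[_]]; rewrite -e.
Qed.

Definition aa_mul : AA :=
  mk_aa comp_dom_subtree comp_cod_subtree comp_bij comp_parent.

End comp.

Section inverse.
Variable f : AA.

Lemma finv_parent :
  parent_iso (aa_cod f) (aa_dom f) (finv (aa_dom f) f).
Proof.
move=> w nw; have [v nv <-] := aa_surj nw.
rewrite (finvK (aa_bij f))//.
have [[? ?]|[nfp e]] := aa_parent nv; first by left.
right; rewrite e (finvK (aa_bij f))//; split => //.
exact: aa_notin_cod.
Qed.

Definition aa_inv : AA := mk_aa (aa_cod_subtree f) (aa_dom_subtree f)
  (finv_bij (aa_bij f)) finv_parent.

Lemma aa_invK v : ~ aa_dom f v -> aa_inv (f v) = v.
Proof. exact: (finvK (aa_bij f)). Qed.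

Lemma aa_invKV v : ~ aa_cod f v -> f (aa_inv v) = v.
Proof. by move=> /aa_surj[u nu <-]; rewrite aa_invK. Qed.

End inverse.

Lemma aa_mul_equiv f f' g g' :
  aa_equiv f f' -> aa_equiv g g' -> aa_equiv (aa_mul f g) (aa_mul f' g').
Proof.
move=> [C [/finite_subtreeP[fC C0 Cp] sC ff']].
move=> [D [/finite_subtreeP[fD D0 Dp] sD gg']].
exists [set v | D v \/ ~ D v /\ C (g v)]; split.
- apply/finite_subtreeP; split; [|by left|].
    apply: (@sub_finite_set _ _ (D `|` [set v | ~ aa_dom g v /\ C (g v)])).
      move=> v [?|[nDv ?]]; first by left.
      by right; split => // ?; apply: nDv; apply: sD; left.
    by rewrite finite_setU; split => //; exact: finite_aa_preim.
  move=> v [/Dp|[nDv Cgv]]; first by left.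
  have [?|nDp] := pselect (D (parent v)); [by left|right; split => //].
  have ngv : ~ aa_dom g v by move=> ?; apply: nDv; apply: sD; left.
  have [[? _]|[_ <-]] := aa_parent ngv; last exact: Cp.
  by case: nDp; apply: sD; left.
- move=> v; have [Dv|nDv] := pselect (D v); first by left.
  move=> [[?|[_ ?]]|[?|[_ ?]]].
  + by left; apply: sD; left.
  + by right; split => //; apply: sC; left.
  + by left; apply: sD; right.
  + by right; split => //; rewrite gg'//; apply: sC; right.
- move=> v /not_orP[nDv /not_andP[//|nCv]] /=.
  by rewrite -gg'// ff'.
Qed.

Lemma aa_inv_equiv f f' : aa_equiv f f' -> aa_equiv (aa_inv f) (aa_inv f').
Proof.
move=> [C [/finite_subtreeP[fC C0 Cp] sC ff']].
have /finite_subtreeP[fB B0 Bp] := aa_cod_subtree f.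
exists (aa_cod f `|` aa_cod f' `|` f @` (C `\` aa_dom f)); split.
- apply/finite_subtreeP; split; [|by left; left|].
    rewrite !finite_setU; split; first split => //.
      by have [] := aa_cod_subtree f'.
    by apply: finite_image; exact: finite_setD.
  move=> w [[/Bp|Bw]|[v [Cv nfv] <-]]; first by left; left.
    by have /finite_subtreeP[_ _ +] := aa_cod_subtree f' => /(_ _ Bw); left; right.
  have [[_]|[nfp ->]] := aa_parent nfv; first by left; left.
  by right; exists (parent v) => //; split => //; exact: Cp.
- by move=> w [?|?]; left; [left|right].
- move=> w /not_orP[/not_orP[/aa_surj[v nfv <-] _]] nw.
  have nC : ~ C v by move=> ?; apply: nw; exists v.
  rewrite aa_invK// ff'// aa_invK// => ?; apply: nC; apply: sC; right => //.
Qed.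

End neretin.

Definition neretin (d k : nat) : Type := {eq_quot (aa_equiv_rel d k)}%qT.
HB.instance Definition _ d k := Choice.on (neretin d k).
HB.instance Definition _ d k := EqQuotient.on (neretin d k).

Section neretin_group.
Variables d k : nat.
Local Notation AA := (almost_aut d k).
Local Notation N := (neretin d k).
Implicit Types (f g h : AA) (x y z : N).

Definition neretin_class f : N := (\pi_N f)%qT.

Lemma neretin_classP f g : neretin_class f = neretin_class g <-> aa_equiv f g.
Proof.
split => [/eqmodP /asboolP//|fg]; apply/eqmodP; exact/asboolP.
Qed.

Lemma neretin_class_ind (P : N -> Prop) : (forall f, P (neretin_class f)) -> forall x, P x.
Proof. by move=> Pf x; rewrite -[x]reprK; exact: Pf. Qed.

Definition neretin_mul x y := neretin_class (aa_mul (repr x) (repr y)).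
Definition neretin_inv x := neretin_class (aa_inv (repr x)).
Definition neretin_one := neretin_class (aa_one d k).

Lemma aa_equiv_repr f : aa_equiv (repr (neretin_class f)) f.
Proof. by apply/neretin_classP; rewrite /neretin_class reprK. Qed.

Lemma neretin_mulE f g : neretin_mul (neretin_class f) (neretin_class g) = neretin_class (aa_mul f g).
Proof. by apply/neretin_classP; apply: aa_mul_equiv; exact: aa_equiv_repr. Qed.

Lemma neretin_invE f : neretin_inv (neretin_class f) = neretin_class (aa_inv f).
Proof. by apply/neretin_classP; apply: aa_inv_equiv; exact: aa_equiv_repr. Qed.

Lemma neretin_mulA : associative neretin_mul.
Proof.
elim/neretin_class_ind => f; elim/neretin_class_ind => g; elim/neretin_class_ind => h.
by rewrite !neretin_mulE; apply/neretin_classP; exact: aa_equiv_eq.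
Qed.

Lemma neretin_mul1 : left_id neretin_one neretin_mul.
Proof.
by elim/neretin_class_ind => f; rewrite neretin_mulE; apply/neretin_classP; exact: aa_equiv_eq.
Qed.

Lemma neretin_mulr1 : right_id neretin_one neretin_mul.
Proof.
by elim/neretin_class_ind => f; rewrite neretin_mulE; apply/neretin_classP; exact: aa_equiv_eq.
Qed.

Lemma neretin_class_eq f g C : finite_subtree C -> (forall v, ~ C v -> f v = g v) ->
  neretin_class f = neretin_class g.
Proof.
move=> tC fg; apply/neretin_classP; exists (aa_dom f `|` aa_dom g `|` C); split.
- by do 2![apply: finite_subtreeU => //]; exact: aa_dom_subtree.
- by left.
- by move=> v /not_orP[_ /fg].
Qed.

Lemma neretin_mulV : left_inverse neretin_one neretin_inv neretin_mul.
Proof.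
elim/neretin_class_ind => f; rewrite neretin_invE neretin_mulE.
by apply: (neretin_class_eq (aa_dom_subtree f)) => v nv /=; exact: aa_invK.
Qed.

Lemma neretin_mulrV : right_inverse neretin_one neretin_inv neretin_mul.
Proof.
elim/neretin_class_ind => f; rewrite neretin_invE neretin_mulE.
by apply: (neretin_class_eq (aa_cod_subtree f)) => v nv /=; exact: aa_invKV.
Qed.

HB.instance Definition _ := isGroup.Build N neretin_mulA neretin_mul1
  neretin_mulr1 neretin_mulV neretin_mulrV.

End neretin_group.


Record tree_aut (d k : nat) := TreeAut {
  ta_fun :> vertex d k -> vertex d k;
  ta_bij : bijective ta_fun;
  ta_root : ta_fun (root d k) = root d k;
  ta_adjacent : forall u v, adjacent (ta_fun u) (ta_fun v) = adjacent u v
}.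
HB.instance Definition _ d k := gen_eqMixin (tree_aut d k).
HB.instance Definition _ d k := gen_choiceMixin (tree_aut d k).
(* The profinite topology of Aut(T_{d,k}) is that of pointwise convergence on the
   discrete set of vertices. *)
HB.instance Definition _ d k := Topological.copy (tree_aut d k)
  (initial_topology (@ta_fun d k : _ -> {ptws vertex d k -> vertex d k})).

Section tree_aut.
Variables d k : nat.
Local Notation V := (vertex d k).
Local Notation Aut := (tree_aut d k).
Local Notation root := (root d k).
Implicit Types (a b : Aut) (u v w : V).

Lemma ta_eq a b : a =1 b -> a = b.
Proof.
case: a b => [f fb f0 fadj] [g gb g0 gadj] /= /funext fg.
by subst g; congr TreeAut; exact: Prop_irrelevance.
Qed.

Lemma ta_inj a : injective a. Proof. exact: bij_inj (ta_bij a). Qed.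

Lemma set_bij_root (f : V -> V) : bijective f -> f root = root ->
  set_bij (~` [set root]) (~` [set root]) f.
Proof.
move=> fb f0; have fi := bij_inj fb; split.
- by move=> v nv e; apply: nv; apply: fi; rewrite f0.
- by move=> u v _ _; exact: fi.
- have [g gK Kg] := fb; move=> w nw; exists (g w); last exact: Kg.
  by move=> e; apply: nw; rewrite -(Kg w) e f0.
Qed.

Lemma ta_parent a v : parent (a v) = a (parent v).
Proof.
have [->|v0] := eqVneq v root; first by rewrite parent_root !ta_root.
have /(_ v) := (parent_isoP (finite_subtree_root d k) (finite_subtree_root d k)
  (set_bij_root (ta_bij a) (ta_root a))).1 (fun u v _ _ => ta_adjacent a u v).
case; first exact/eqP.
  by move=> [-> ->]; rewrite ta_root.
by case.
Qed.

Lemma parent_adjacent (f : V -> V) : injective f -> f root = root ->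
  (forall v, parent (f v) = f (parent v)) ->
  forall u v, adjacent (f u) (f v) = adjacent u v.
Proof.
move=> fi f0 fp u v.
have fr w : (f w == root) = (w == root) by rewrite -{1}f0 (inj_eq fi).
by rewrite /adjacent /child_of !fp !fr !(inj_eq fi).
Qed.

Definition mk_ta (f : V -> V) (fb : bijective f) (f0 : f root = root)
    (fp : forall v, parent (f v) = f (parent v)) : Aut :=
  TreeAut fb f0 (parent_adjacent (bij_inj fb) f0 fp).

Definition ta_one : Aut := @mk_ta id (Bijective (frefl _) (frefl _)) erefl
  (fun=> erefl).

Definition ta_mul a b : Aut.
Proof.
apply: (@mk_ta (a \o b)) => [||v] /=.
- exact: bij_comp (ta_bij a) (ta_bij b).
- by rewrite !ta_root.
- by rewrite !ta_parent.
Defined.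


Definition ta_inv_fun a v : V := xget root [set u | a u = v].

Lemma ta_inv_funKV a v : a (ta_inv_fun a v) = v.
Proof.
have [g _ Kg] := ta_bij a; rewrite /ta_inv_fun.
by case: xgetP => [//|/(_ (g v))] []; exact: Kg.
Qed.

Lemma ta_inv_funK a v : ta_inv_fun a (a v) = v.
Proof. by apply: (@ta_inj a); rewrite ta_inv_funKV. Qed.

Definition ta_inv a : Aut.
Proof.
apply: (@mk_ta (ta_inv_fun a)) => [||v].
- by exists a; [exact: ta_inv_funKV|exact: ta_inv_funK].
- by rewrite -{1}(ta_root a) ta_inv_funK.
- by apply: (@ta_inj a); rewrite -ta_parent !ta_inv_funKV.
Defined.

Lemma ta_mulA : associative ta_mul. Proof. by move=> a b c; exact: ta_eq. Qed.
Lemma ta_mul1 : left_id ta_one ta_mul. Proof. by move=> a; exact: ta_eq. Qed.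
Lemma ta_mulr1 : right_id ta_one ta_mul. Proof. by move=> a; exact: ta_eq. Qed.
Lemma ta_mulV : left_inverse ta_one ta_inv ta_mul.
Proof. by move=> a; apply: ta_eq => v; exact: ta_inv_funK. Qed.
Lemma ta_mulrV : right_inverse ta_one ta_inv ta_mul.
Proof. by move=> a; apply: ta_eq => v; exact: ta_inv_funKV. Qed.

HB.instance Definition _ := isGroup.Build Aut ta_mulA ta_mul1 ta_mulr1
  ta_mulV ta_mulrV.

Lemma ta_mulE a b v : (a * b)%g v = a (b v). Proof. by []. Qed.
Lemma ta_invKV a v : a (a^-1%g v) = v. Proof. exact: ta_inv_funKV. Qed.
Lemma ta_invK a v : a^-1%g (a v) = v. Proof. exact: ta_inv_funK. Qed.

Definition agree (F : set V) (f g : V -> V) := forall v, F v -> f v = g v.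

Lemma nbhs_ptws (f : {ptws V -> V}) (U : set {ptws V -> V}) :
  nbhs f U <-> exists2 F, finite_set F & forall g, agree F g f -> U g.
Proof.
split; last first.
  move=> [F /finite_fsetP[D ->] DU].
  pose C v := [set g : {ptws V -> V} | g v = f v].
  suff : nbhs f (\bigcap_(v in [set` D]) C v).
    by apply: filterS => g gf; apply: DU => v Dv; exact: gf.
  apply: filter_bigI => v _.
  have := @proj_continuous V (fun=> V) v f [set f v].
  by apply; rewrite nbhs_principalE; exact/principal_filterP.
pose Fi := filter_from (@finite_set V) (fun F => [set g | agree F g f]).
have FFi : Filter Fi.
  apply: filter_from_filter; first by exists set0.
  move=> F G fF fG; exists (F `|` G); first by rewrite finite_setU.
  by move=> g gf; split => v ?; apply: gf; [left|right].
move=> fU; suff FiF : (Fi : set_system {ptws V -> V}) --> f.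
  by have [F fF FU] := FiF _ fU; exists F.
apply/cvg_sup => v.
change (Fi --> (f : initial_topology (fun g : V -> V => g v))).
move=> A; rewrite /= (@nbhsE (initial_topology (fun g : V -> V => g v))).
move=> [_ [[W oW <-] Wf] WA].
exists [set v]; first exact: finite_set1.
by move=> g /(_ v erefl) gf; apply: WA; rewrite /= gf.
Qed.

Lemma nbhs_ta a (U : set Aut) :
  nbhs a U <-> exists2 F, finite_set F & forall b, agree F b a -> U b.
Proof.
split.
  rewrite nbhsE; move=> [_ [[W oW <-] Wa] WU].
  have /nbhs_ptws[F fF FW] : nbhs (ta_fun a : {ptws V -> V}) W.
    exact: open_nbhs_nbhs.
  by exists F => // b /FW; exact: WU.
move=> [F fF FU].
have ca : {for a, continuous (@ta_fun d k : Aut -> {ptws V -> V})}.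
  exact: initial_continuous.
apply: (@filterS _ _ _ ((@ta_fun d k) @^-1` [set g | agree F g a])).
  by move=> b; exact: FU.
by apply: ca; apply/nbhs_ptws; exists F.
Qed.

Lemma open_ta (U : set Aut) : open U <-> forall a, U a ->
  exists2 F, finite_set F & forall b, agree F b a -> U b.
Proof.
by rewrite openE; split => h a /h; [move/nbhs_ta|move=> ?; apply/nbhs_ta].
Qed.

Definition aut_aa a : almost_aut d k.
Proof.
apply: (@mk_aa _ _ [set root] [set root] a); try exact: finite_subtree_root.
- exact: set_bij_root (ta_bij a) (ta_root a).
- move=> v _; have [e|e] := pselect (parent v = root); [left|right].
    by split => //=; rewrite ta_parent e ta_root.
  by rewrite ta_parent.
Defined.

Definition neretin_of_aut a : neretin d k := neretin_class (aut_aa a).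

Lemma neretin_of_autM a b :
  neretin_of_aut (a * b)%g = (neretin_of_aut a * neretin_of_aut b)%g.
Proof.
by rewrite /neretin_of_aut [RHS]neretin_mulE; apply/neretin_classP/aa_equiv_eq.
Qed.

Lemma neretin_of_aut1 : neretin_of_aut 1%g = 1%g.
Proof. by apply/neretin_classP/aa_equiv_eq. Qed.

Lemma neretin_of_autV a : neretin_of_aut a^-1%g = (neretin_of_aut a)^-1%g.
Proof.
apply/esym/(@mulIg _ (neretin_of_aut a)).
by rewrite /= mulVg -neretin_of_autM mulVg neretin_of_aut1.
Qed.

End tree_aut.

Section neretin_topology.
Variables d k : nat.
Local Notation V := (vertex d k).
Local Notation Aut := (tree_aut d k).
Local Notation N := (neretin d k).
Local Notation root := (root d k).
Local Notation iota := (@neretin_of_aut d k).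
Implicit Types (a b : Aut) (u v w : V) (x y : N).

(* The only group topology for which the inclusion of Aut(T_{d,k}) is continuous
   and open: U is open iff all its left translates have an open trace on
   Aut(T_{d,k}).  See neretin_of_aut_continuous, neretin_of_aut_open and
   neretin_topology_unique; for d > 0 the inclusion is injective
   (neretin_of_aut_inj), and the topology is Hausdorff and locally compact
   (neretin_hausdorff, neretin_locally_compact). *)
Definition neretin_open (U : set N) : Prop :=
  forall x, open [set a | U (x * iota a)%g].

Lemma neretin_openT : neretin_open setT.
Proof. by move=> x; exact: openT. Qed.

Lemma neretin_openI : setI_closed neretin_open.
Proof. by move=> A B oA oB x; exact: openI (oA x) (oB x). Qed.

Lemma neretin_open_bigU (I : Type) (f : I -> set N) :
  (forall i, neretin_open (f i)) -> neretin_open (\bigcup_i f i).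
Proof. by move=> fo x; apply: bigcup_open => i _; exact: fo. Qed.

HB.instance Definition _ :=
  isOpenTopological.Build N neretin_openT neretin_openI neretin_open_bigU.

Lemma neretin_openE (U : set N) : open U <-> neretin_open U.
Proof. by []. Qed.

Definition fixer (F : set V) : set N :=
  [set iota a | a in [set a : Aut | forall v, F v -> a v = v]].

Lemma open_fixer F x : finite_set F ->
  open [set (x * h)%g | h in fixer F].
Proof.
move=> fF; apply/neretin_openE => y; apply/open_ta => a [_ [b bF <-] e].
exists F => // c ca; exists (iota (b * a^-1 * c)%g).
  by exists (b * a^-1 * c)%g => // v Fv; rewrite !ta_mulE ca// ta_invK bF.
by rewrite !neretin_of_autM !mulgA e neretin_of_autV mulgK.
Qed.

Lemma neretin_nbhs x U : nbhs x U <->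
  exists2 F, finite_set F & [set (x * h)%g | h in fixer F] `<=` U.
Proof.
split.
  rewrite nbhsE => -[W [oW Wx] WU].
  have /open_ta/(_ 1%g) := (oW : neretin_open W) x.
  rewrite /= neretin_of_aut1 mulg1 => /(_ Wx)[F fF FW].
  exists F => // _ [_ [a aF <-] <-]; apply: WU; exact: FW.
move=> [F fF FU]; rewrite nbhsE; exists [set (x * h)%g | h in fixer F] => //.
split; first exact: open_fixer.
exists 1%g; last by rewrite mulg1.
by exists 1%g => //; rewrite neretin_of_aut1.
Qed.

Lemma fixer_mul F x y : fixer F x -> fixer F y -> fixer F (x * y)%g.
Proof.
move=> [a aF <-] [b bF <-]; exists (a * b)%g; last exact: neretin_of_autM.
by move=> v Fv; rewrite ta_mulE bF// aF.
Qed.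

Lemma fixer_inv F x : fixer F x -> fixer F (x^-1)%g.
Proof.
move=> [a aF <-]; exists (a^-1)%g; last exact: neretin_of_autV.
by move=> v Fv; rewrite -{1}(aF v Fv) ta_invK.
Qed.


Lemma finite_children (A : set V) :
  finite_set A -> finite_set [set v | A (parent v)].
Proof.
move=> fA; pose ch u (x : 'I_d + 'I_k) : V := match x, u with
  | inl j, Some (i, s) => Some (i, j :: s)
  | inr i, _ => Some (i, [::])
  | _, _ => None
  end.
apply: (@sub_finite_set _ _ (root |` \bigcup_(u in A) range (ch u))).
  move=> [[i [|j s]]|] /= Av; last by left.
  - by right; exists None => //; exists (inr i).
  - by right; exists (Some (i, s)) => //; exists (inl j).
rewrite finite_setU; split; first exact: finite_set1.
by apply: bigcup_finite => // u _; exact: finite_image.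
Qed.

Lemma finite_boundary (A : set V) : finite_subtree A -> finite_set (boundary A).
Proof.
move=> tA; have [fA _ _] := tA; rewrite boundaryE//.
by apply: sub_finite_set (finite_children fA) => v [].
Qed.

Lemma conj_fixer x F : finite_set F -> exists2 F', finite_set F' &
  forall y, fixer F' y -> fixer F (x * y * x^-1)%g.
Proof.
elim/neretin_class_ind: x => f fF.
have tA := aa_dom_subtree f; have [fA _ _] := tA.
have tB := aa_cod_subtree f; have /finite_subtreeP[fB B0 Bp] := tB.
exists (aa_dom f `|` boundary (aa_dom f) `|` aa_inv f @` F).
  by rewrite !finite_setU; split; [split => //; exact: finite_boundary|
    exact: finite_image].
move=> _ [a aF <-].
pose c a w := if pselect (aa_cod f w) then w else f (a (aa_inv f w)).
have cB a' w : aa_cod f w -> c a' w = w by rewrite /c; case: pselect.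
have cNB a' v : ~ aa_dom f v -> c a' (f v) = f (a' v).
  move=> nv; rewrite /c; case: pselect => [Bv|nBv]; last by rewrite aa_invK.
  by case: (aa_notin_cod nv).
have aA v : aa_dom f v -> a v = v by move=> Av; apply: aF; left; left.
have naA v : ~ aa_dom f v -> ~ aa_dom f (a v).
  by move=> nv Av; apply: nv; rewrite -(ta_inj (aA _ Av)).
have naA' v : ~ aa_dom f v -> ~ aa_dom f (a^-1%g v).
  by move=> nv Av; apply: nv; rewrite -(ta_invKV a v) aA.
have bc : bijective (c a).
  exists (c (a^-1)%g) => w; have [Bw|/aa_surj[v nv <-]] := pselect (aa_cod f w).
  - by rewrite !cB.
  - by rewrite !cNB ?ta_invK//; exact: naA.
  - by rewrite !cB.
  - by rewrite !cNB ?ta_invKV//; exact: naA'.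
have pc w : parent (c a w) = c a (parent w).
  have [Bw|/aa_surj[v nv <-]] := pselect (aa_cod f w).
    by rewrite !cB//; exact: Bp.
  rewrite cNB//; have [[Apv Bpv]|[nApv ->]] := aa_parent nv.
    rewrite cB// aF//; left; right; rewrite boundaryE//.
  rewrite cNB//; have [[]|[_ ->]] := aa_parent (naA _ nv).
    by rewrite ta_parent => /naA.
  by rewrite ta_parent.
exists (mk_ta bc (cB _ _ B0) pc).
  move=> w Fw /=; have [Bw|nBw] := pselect (aa_cod f w); first by rewrite cB.
  have [v nv vw] := aa_surj nBw; rewrite -vw cNB// aF//.
  by right; exists w => //; rewrite -vw aa_invK.
rewrite [RHS](_ : _ = neretin_class (aa_mul (aa_mul f (aut_aa a)) (aa_inv f))); last first.
  by rewrite -!neretin_mulE -neretin_invE.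
apply: (neretin_class_eq tB) => w nBw /=; have [v nv <-] := aa_surj nBw.
by rewrite cNB// (finvK (aa_bij f)).
Qed.

Lemma mul_fixer F x y z : fixer F y -> z = (x * y)%g ->
  [set (x * h)%g | h in fixer F] z.
Proof. by move=> yF ->; exists y. Qed.

Lemma neretin_mulg_continuous : continuous (fun xy : N * N => (xy.1 * xy.2)%g).
Proof.
move=> [x y] U /= /neretin_nbhs[F fF FU].
have [F' fF' F'F] := conj_fixer (y^-1)%g fF.
exists ([set (x * h)%g | h in fixer F'], [set (y * h)%g | h in fixer F]).
  by split; apply/neretin_nbhs; [exists F'|exists F].
move=> [_ _] [/= [g gF' <-] [h hF <-]]; apply: FU.
apply: (mul_fixer (fixer_mul (F'F _ gF') hF)).
by rewrite invgK !mulgA mulgK.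
Qed.

Lemma neretin_invg_continuous : continuous (fun x : N => (x^-1)%g).
Proof.
move=> x U /= /neretin_nbhs[F fF FU].
have [F' fF' F'F] := conj_fixer x fF.
apply/neretin_nbhs; exists F' => // _ [h hF' <-]; apply: FU.
apply: (mul_fixer (F'F _ (fixer_inv hF'))).
by rewrite invgM !mulgA mulVg mul1g.
Qed.

End neretin_topology.

HB.instance Definition _ d k := isTopologicalGroup.Build (neretin d k)
  (@neretin_mulg_continuous d k) (@neretin_invg_continuous d k).

Lemma mulgl_continuous (G : topologicalGroupType) (g : G) :
  continuous (fun h : G => g * h)%g.
Proof.
move=> h; apply: (@continuous_comp _ _ _ (fun h => (g, h))
  (fun xy => (xy.1 * xy.2)%g)); last exact: mulg_continuous.
by apply: cvg_pair; [exact: cvg_cst|exact: cvg_id].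
Qed.

Section neretin_topology_characterization.
Variables d k : nat.
Local Notation V := (vertex d k).
Local Notation Aut := (tree_aut d k).
Local Notation N := (neretin d k).
Local Notation root := (root d k).
Local Notation iota := (@neretin_of_aut d k).
Implicit Types (a b : Aut) (u v w : V) (x y : N).

Lemma neretin_of_aut_continuous : continuous iota.
Proof.
move=> a U /neretin_nbhs[F fF FU]; apply/nbhs_ta; exists F => // b ba.
apply: FU; exists (iota (a^-1 * b)%g).
  by exists (a^-1 * b)%g => // v Fv; rewrite ta_mulE ba// ta_invK.
by rewrite -neretin_of_autM mulgA mulgV mul1g.
Qed.

Lemma neretin_of_aut_open (U : set Aut) : open U -> open (iota @` U).
Proof.
move=> /open_ta oU; apply/neretin_openE => x; apply/open_ta => a [b Ub e].
have [F fF FU] := oU _ Ub; exists F => // c ca.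
exists (b * a^-1 * c)%g.
  by apply: FU => v Fv; rewrite !ta_mulE ca// ta_invK.
by rewrite !neretin_of_autM e neretin_of_autV mulgK.
Qed.

Lemma infinite_descendants v (C : set V) : 0 < d -> v != root -> finite_set C ->
  exists n w, ~ C w /\ iter n (@parent d k) w = v.
Proof.
case: v => [[i s]|//] d0 _ fC; apply: contrapT => nC.
pose w n : V := Some (i, nseq n (Ordinal d0) ++ s).
have wC n : C (w n).
  apply: contrapT => nCw; apply: nC; exists n, (w n); split => //.
  by rewrite /w; elim: n {nCw} => // n IH; rewrite iterSr.
apply: infinite_nat.
apply: (@sub_finite_set _ _ ((fun u => depth u - (size s).+1) @` C)).
  move=> n _; exists (w n) => //=.
  by rewrite size_cat size_nseq; lia.
exact: finite_image.
Qed.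

Lemma neretin_of_aut_inj : 0 < d -> injective iota.
Proof.
move=> d0 a b /neretin_classP[C [[fC _ _] _ ab]]; apply: ta_eq => v.
have [->|v0] := eqVneq v root; first by rewrite !ta_root.
have [n [w [nCw <-]]] := infinite_descendants d0 v0 fC.
have it (c : Aut) m : c (iter m (@parent d k) w) = iter m (@parent d k) (c w).
  by elim: m => //= m <-; rewrite ta_parent.
by rewrite !it; congr iter; exact: ab.
Qed.

Lemma neretin_hausdorff : 0 < d -> hausdorff_space N.
Proof.
move=> d0 x y xy; apply: contrapT => nxy.
have nb (z : N) F : finite_set F -> nbhs z [set (z * h)%g | h in fixer F].
  by move=> fF; apply/neretin_nbhs; exists F.
have [[a _ e]|nr] := pselect (range iota (x^-1 * y)%g); last first.
  have [_ [[_ [a _ <-] <-] [_ [b _ <-] e]]] :=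
    xy _ _ (nb x _ (finite_set0 V)) (nb y _ (finite_set0 V)).
  apply: nr; exists (a * b^-1)%g => //.
  rewrite neretin_of_autM neretin_of_autV; apply: (@mulIg _ (iota b)).
  by rewrite /= mulgVK -mulgA e mulKg.
have [v av] : exists v, a v <> v.
  apply: contrapT => h; apply: nxy.
  have a1 : a = 1%g by apply: ta_eq => v; apply: contrapT => av; apply: h; exists v.
  by move: e; rewrite a1 neretin_of_aut1 => e; rewrite -[y](mulVKg x) -e mulg1.
have [_ [[_ [b bv <-] <-] [_ [c cv <-] e']]] :=
  xy _ _ (nb x _ (finite_set1 v)) (nb y _ (finite_set1 v)).
apply: av; have : iota b = iota (a * c)%g.
  by rewrite neretin_of_autM e -mulgA e' mulKg.
by move=> /(neretin_of_aut_inj d0) bac; rewrite -{1}(cv v erefl) -ta_mulE -bac bv.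
Qed.

Lemma depth_root_eq v : depth v = 0 -> v = root.
Proof. by case: v => [[]|]. Qed.

Lemma ta_depth a v : depth (a v) = depth v.
Proof.
have [n] := ubnP (depth v); elim: n v => // n IH v; rewrite ltnS => vn.
have [->|v0] := eqVneq v root; first by rewrite ta_root.
have av0 : a v != root by rewrite -(ta_root a) (inj_eq (@ta_inj _ _ a)).
rewrite (depth_parent av0) (depth_parent v0) ta_parent IH//.
by rewrite -(depth_parent v0).
Qed.

Lemma finite_ball n : finite_set [set v : V | depth v <= n].
Proof.
elim: n => [|n IH].
  apply: sub_finite_set (finite_set1 root) => v /=.
  by rewrite leqn0 => /eqP/depth_root_eq.
apply: sub_finite_set (finite_children IH) => v /=.
have [->//|v0] := eqVneq v root.
by rewrite depth_parent.
Qed.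

Lemma tree_aut_compact : compact [set: Aut].
Proof.
move=> F PF _.
have := @tychonoff V (fun=> V) (fun v => [set w | depth w <= depth v])
  (fun v => finite_compact (finite_ball _)).
move=> /(_ (@ta_fun d k @ F) _)[].
  change (F [set a : Aut | forall v, depth (a v) <= depth v]).
  by apply: filterS filterT => a _ v; rewrite ta_depth.
move=> f [_ fcl].
have apx P S : F P -> finite_set S -> exists2 a, P a & agree S a f.
  move=> FP fS.
  have [||g [[a Pa <-] ga]] := fcl (@ta_fun d k @` P) [set g | agree S g f].
  - change (F [set a : Aut | (@ta_fun d k @` P) a]).
    by apply: filterS FP => a Pa; exists a.
  - by apply/nbhs_ptws; exists S.
  - by exists a.
have apxT S : finite_set S -> exists2 a, [set: Aut] a & agree S a f.
  by apply: apx; exact: filterT.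
have f0 : f root = root.
  by have [a _ af] := apxT _ (finite_set1 root); rewrite -af// ta_root.
have fp v : parent (f v) = f (parent v).
  have [a _ af] := apxT _ (finite_set2 v (parent v)).
  by rewrite -!af; [exact: ta_parent|right|left].
have fi : injective f.
  move=> u v e; have [a _ af] := apxT _ (finite_set2 u v).
  by apply: (@ta_inj _ _ a); rewrite !af; [|right|left].
have /boolp.choice[g Kg] : forall w, exists v, f v = w.
  move=> w; have [a _ af] := apxT _ (finite_ball (depth w)).
  exists (a^-1 w)%g; rewrite -af ?ta_invKV//.
  by change (depth (a^-1%g w) <= depth w); rewrite ta_depth.
have fb : bijective f by exists g => // v; apply: fi; rewrite Kg.
exists (mk_ta fb f0 fp); split => // P U FP /nbhs_ta[S fS SU].
by have [a Pa af] := apx _ _ FP fS; exists a; split => //; exact: SU.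
Qed.

Lemma neretin_locally_compact : 0 < d -> locally_compact [set: N].
Proof.
move=> d0 x _; pose xi a := (x * iota a)%g.
have xic : continuous xi.
  move=> a; apply: (continuous_comp (neretin_of_aut_continuous (x:=a))).
  exact: mulgl_continuous.
have cK : compact (xi @` setT).
  by apply: continuous_compact tree_aut_compact; exact: continuous_subspaceT.
exists (xi @` setT).
  rewrite withinE/=; exists (xi @` setT); last by rewrite setIT.
  apply/neretin_nbhs; exists set0 => // _ [_ [a _ <-] <-]; by exists a.
by split => //; apply: compact_closed cK; exact: neretin_hausdorff.
Qed.

Lemma neretin_topology_unique (G : topologicalGroupType) (j : N -> G) :
  bijective j -> {morph j : x y / (x * y)%g >-> (x * y)%g} ->
  continuous (j \o iota) -> (forall U, open U -> open ((j \o iota) @` U)) ->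
  forall W : set G, open W <-> open (j @^-1` W).
Proof.
move=> [i ji ij] jM jc jo W.
split=> [oW|/neretin_openE oW].
  apply/neretin_openE => x.
  rewrite (_ : [set a | _] = (fun a => j x * (j \o iota) a)%g @^-1` W); last first.
    by apply/seteqP; split => a /=; rewrite jM.
  apply: open_comp => // a _.
  exact: (continuous_comp (jc a) (@mulgl_continuous _ _ _)).
rewrite openE => g Wg.
have oU := oW (i g).
have /continuousP oV := @mulgl_continuous G (g^-1)%g.
have {}oV := oV _ (jo _ oU).
apply: (filterS _ (open_nbhs_nbhs (conj oV _))); last first.
  exists 1%g; first by rewrite /= neretin_of_aut1 mulg1 ij.
  by rewrite /= neretin_of_aut1 mulVg; apply: (@mulgI _ (j 1%g)); rewrite -jM !mulg1.
move=> h [a Wa] e; move: Wa; rewrite /= jM ij.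
by rewrite -[j (iota a)]/((j \o iota) a) e mulVKg.
Qed.

End neretin_topology_characterization.

Local Open Scope ring_scope.

(* hdot is linear in its first argument and conjugate linear in its second one. *)
HB.mixin Record isHilbert (R : realType) H & CompleteNormedModule R[i] H := {
  hdot : {dot H for (@Num.conj R[i])};
  hdot_norm : forall x : H, hdot x x = `|x| ^+ 2
}.

#[short(type="hilbertType")]
HB.structure Definition Hilbert (R : realType) :=
  {H of CompleteNormedModule R[i] H & isHilbert R H}.

Section operators.
Context {R : realType} {H : hilbertType R}.
Implicit Types (S T p z : H -> H) (M : set (H -> H)).

Definition bounded_operator : set (H -> H) :=
  [set T | linear T /\ continuous T].

Definition commutant M : set (H -> H) :=
  [set T | bounded_operator T /\ forall S, M S -> T \o S = S \o T].

(* The double commutant M''. *)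
Definition generated_vN M := commutant (commutant M).

Definition projection p :=
  [/\ bounded_operator p, p \o p = p &
      forall x y, hdot (p x) y = hdot x (p y)].

(* The corner p M p is commutative. *)
Definition abelian_projection M p :=
  [/\ M p, projection p &
    forall S T, M S -> M T ->
      (p \o S \o p) \o (p \o T \o p) = (p \o T \o p) \o (p \o S \o p)].

(* Every nonzero central projection of M majorizes a nonzero abelian one. *)
Definition type_I_vN M :=
  forall z, M z -> commutant M z -> projection z -> z <> cst 0 ->
  exists p, [/\ abelian_projection M p, p <> cst 0 & z \o p = p].

End operators.

(* Each operator is isometric, and invertible by urep1 and urepM, hence unitary;
   continuity is with respect to the strong operator topology. *)
Record unitary_rep (G : topologicalGroupType) (R : realType)
    (H : hilbertType R) := UnitaryRep {
  urep :> G -> H -> H;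
  urep_linear : forall g, linear (urep g);
  urep_unitary : forall g x y, hdot (urep g x) (urep g y) = hdot x y;
  urep1 : urep 1%g = id;
  urepM : forall g h, urep (g * h)%g = urep g \o urep h;
  urep_continuous : forall x : H, continuous (fun g => urep g x)
}.

Definition type_I_group (R : realType) (G : topologicalGroupType) :=
  forall (H : hilbertType R) (pi : unitary_rep G H),
    type_I_vN (generated_vN (range pi)).

(* Main.v *)
From HB Require Import structures.
From mathcomp Require Import all_boot all_order all_algebra all_fingroup finmap complex zify.
From mathcomp Require Import all_classical all_reals all_analysis.
From mathcomp Require Import ring lra.
Require Import Defs.

(** Let [K_n] be the fixer of the ball of radius [n + 1] in the rooted tree, and
    let [G], the Neretin group, act by left translations on the [l^2] space of
    all sets [x K_n y].  The von Neumann algebra [M] generated by this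
    representation has no nonzero abelian projection [p].  Indeed right
    translations commute with [M], so if [p] is nonzero then
    [a = |p delta_L|^2] is positive for a conjugate [L = x K_m x^-1].

    For [n >= m] put [S = x K_n x^-1] and [t = |p delta_S|^2].  The operator
    which pulls functions on the cosets of [L] back to the cosets of [S]
    commutes with [M], whence [a <= [L : S] t].  The symmetric group [F] on the
    [N = k d^n] vertices of depth [n + 1] embeds in [G], permuting the
    subtrees which hang there; after conjugation by [x] it normalises [S] and
    meets it trivially.  Thus the [u delta_S] with [u] in [F] are orthonormal and
    [u delta_S] is also the image of [delta_S] under a right translation, so
    that the vector state of [delta_S] restricts to an [F]-invariant state
    on [M].  Since [p u p v p = p v p u p], the sums over [u], [v] in [F] of
    [<p u p v p delta_S, u v delta_S>] and of [<p v p u p delta_S, u v delta_S>]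
    coincide.  The first one is at least [|F|^2 t^3], by Cauchy-Schwarz, while
    the second one is small because few pairs of elements of [F] commute; the
    outcome is that [t^9 |F|] is at most the number of conjugacy classes of
    [F], which is at most [2^N].  As [[L : S] <= d^(2 N)], we get
    [a^9 N! <= (2 d^18)^N] for arbitrarily large [N], which is absurd. *)

Set Implicit Arguments.
Unset Strict Implicit.
Unset Printing Implicit Defensive.
Import Order.TTheory GRing.Theory Num.Theory numFieldNormedType.Exports.
Local Open Scope classical_set_scope.
Local Open Scope ring_scope.

(** * Square-summable families *)

Section total_sum.
Variables (R : realType) (X : choiceType).
Implicit Types (u v : X -> R) (A B : {fset X}).

Definition psum u A := \sum_(x <- A) u x.

(** The finite subsets directed by inclusion: limits along this filter are unordered sums. *)
Definition fsets_filter : set_system {fset X} :=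
  filter_from setT (fun A => [set B | (A `<=` B)%fset]).

Global Instance fsets_filter_proper : ProperFilter fsets_filter.
Proof.
eapply filter_from_proper; last by move=> A _; exists A; rewrite /= fsubset_refl.
apply: filter_fromT_filter; first by exists fset0.
by move=> A B /=; exists (A `|` B)%fset => P /=; rewrite fsubUset => /andP[].
Qed.

Definition summation u : R := lim (psum u @ fsets_filter).

Definition abs_summable u := exists M, forall A, psum (fun x => `|u x|) A <= M.

Lemma psumD u v A : psum (u \+ v) A = psum u A + psum v A.
Proof. exact: big_split. Qed.

Lemma psumZ c u A : psum (fun x => c * u x) A = c * psum u A.
Proof. by rewrite /psum mulr_sumr. Qed.

Lemma psum_le u v A : (forall x, u x <= v x) -> psum u A <= psum v A.
Proof. by move=> uv; apply: ler_sum. Qed.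

Lemma psum_subset u A B : (forall x, 0 <= u x) -> (A `<=` B)%fset ->
  psum u A <= psum u B.
Proof.
move=> u0 AB; rewrite /psum (big_fsetID _ (mem A) B)/=.
rewrite (_ : [fset x in B | x \in A]%fset = A); last first.
  by apply/fsetP => x; rewrite !inE /= andbC; case: (boolP (x \in A)) => // /(fsubsetP AB).
by rewrite lerDl; apply: sumr_ge0.
Qed.

Lemma ge0_cvg_psum u M : (forall x, 0 <= u x) -> (forall A, psum u A <= M) ->
  psum u @ fsets_filter --> sup (range (psum u)).
Proof.
move=> u0 uM; have hs : has_sup (range (psum u)).
  by split; [exists (psum u fset0), fset0|exists M => _ [A _ <-]].
apply/cvgrPdist_lt => e e0.
have [_ [A _ <-] Ae] := sup_adherent e0 hs.
exists A => // B /= AB.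
have BS : psum u B <= sup (range (psum u)) by apply: (sup_upper_bound hs); exists B.
have := psum_subset u0 AB; rewrite ger0_norm; [move=> ?; lra|lra].
Qed.

(** Both [|u|] and [|u| + u] are nonnegative with bounded partial sums; their limits are
    subtracted. *)
Lemma summable_cvg u : abs_summable u -> cvg (psum u @ fsets_filter).
Proof.
move=> [M uM].
have h1 : psum (fun x => `|u x|) @ fsets_filter --> sup (range (psum (fun x => `|u x|))).
  exact: ge0_cvg_psum uM.
have h2 : psum (fun x => `|u x| + u x) @ fsets_filter -->
    sup (range (psum (fun x => `|u x| + u x))).
  apply: (@ge0_cvg_psum _ (2 * M)) => [x|A].
    by have := ler_norm (- u x); rewrite normrN; lra.
  apply: (@le_trans _ _ (2 * psum (fun x => `|u x|) A)).
    by rewrite -psumZ; apply: psum_le => x; have := ler_norm (u x); lra.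
  by rewrite ler_pM2l// uM.
have := cvgB h2 h1; rewrite (_ : psum _ - psum _ = psum u).
  by move=> h; apply/cvg_ex; eexists; exact: h.
apply/funext => A /=.
by rewrite -[LHS]/(psum _ A - psum _ A) psumD addrAC subrr add0r.
Qed.

Lemma summation_cvg u : abs_summable u -> psum u @ fsets_filter --> summation u.
Proof. exact: summable_cvg. Qed.

Lemma summationD u v : abs_summable u -> abs_summable v ->
  summation (u \+ v) = summation u + summation v.
Proof.
move=> su sv; apply: cvg_lim => //.
rewrite (_ : psum (u \+ v) = psum u + psum v).
  exact: cvgD (summation_cvg su) (summation_cvg sv).
by apply/funext => A; rewrite psumD.
Qed.

Lemma summationZ c u : abs_summable u -> summation (fun x => c * u x) = c * summation u.
Proof.
move=> su; apply: cvg_lim => //.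
rewrite (_ : psum (fun x => c * u x) = (fun A => c * psum u A)).
  exact: cvgMr (summation_cvg su).
by apply/funext => A; rewrite psumZ.
Qed.

Lemma abs_summableD u v : abs_summable u -> abs_summable v -> abs_summable (u \+ v).
Proof.
move=> [M uM] [L vL]; exists (M + L) => A.
apply: le_trans (lerD (uM A) (vL A)); rewrite -psumD.
by apply: psum_le => x; exact: ler_normD.
Qed.

Lemma abs_summableZ c u : abs_summable u -> abs_summable (fun x => c * u x).
Proof.
move=> [M uM]; exists (`|c| * M) => A; apply: le_trans (ler_wpM2l _ (uM A)) => //.
by rewrite -psumZ; apply: psum_le => x; rewrite normrM.
Qed.

Lemma abs_summable_le u v : (forall x, `|u x| <= v x) -> abs_summable v -> abs_summable u.
Proof.
move=> uv [M vM]; exists M => A; apply: le_trans (vM A); apply: psum_le => x.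
by apply: le_trans (uv x) _; exact: ler_norm.
Qed.

Lemma psum_le_summation u A : (forall x, 0 <= u x) -> abs_summable u ->
  psum u A <= summation u.
Proof.
move=> u0 su; apply: limr_ge (summable_cvg su) _.
by exists A => // B /=; exact: psum_subset.
Qed.

Lemma summation_le u M : abs_summable u -> (forall A, psum u A <= M) ->
  summation u <= M.
Proof.
move=> su uM; apply: limr_le (summable_cvg su) _.
by exists fset0 => // B _ /=; exact: uM.
Qed.

Lemma summation_fset u A : (forall x, x \notin A -> u x = 0) ->
  summation u = psum u A.
Proof.
move=> uA; apply: cvg_lim => //; apply: cvg_near_cst.
exists A => // B /= AB; rewrite /psum (big_fsetID _ (mem A) B)/= addrC big1_fset ?add0r.
  congr bigop; rewrite (_ : [fset x in B | x \in A]%fset = A)//.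
  by apply/fsetP => x; rewrite !inE /= andbC; case: (boolP (x \in A)) => // /(fsubsetP AB).
by move=> x; rewrite !inE /= => /andP[_ /uA].
Qed.

Lemma summation_reindex u (f g : X -> X) : cancel f g -> cancel g f ->
  summation (u \o f) = summation u.
Proof.
move=> fK gK; rewrite /summation.
rewrite (_ : psum (u \o f) @ fsets_filter = psum u @ fsets_filter)//.
have im (h : X -> X) (hi : injective h) A : psum (u \o h) A = psum u (h @` A)%fset.
  by rewrite /psum big_imfset//= => x y _ _; exact: hi.
apply/seteqP; split => P [A _ AP] /=.
- exists [fset f x | x in A]%fset => // B /= AB.
  have -> : psum u B = psum (u \o f) (g @` B)%fset.
    rewrite im; last exact: can_inj fK.
    congr psum; apply/fsetP => x; apply/idP/imfsetP => /= [xB|[y /imfsetP[z /= zB ->] ->]].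
      by exists (g x) => //; apply/imfsetP; exists x.
    by rewrite gK.
  apply: AP => /=; apply/fsubsetP => x xA; apply/imfsetP; exists (f x) => //=.
  by apply: (fsubsetP AB); apply/imfsetP; exists x.
- exists [fset g x | x in A]%fset => // B /= AB.
  rewrite im; last exact: can_inj fK.
  apply: AP => /=; apply/fsubsetP => x xA; apply/imfsetP; exists (g x) => //=.
  by apply: (fsubsetP AB); apply/imfsetP; exists x.
Qed.

End total_sum.

Section complex_sum.
Variables (R : realType) (X : choiceType).
Implicit Types (u v : X -> R[i]) (a : R[i]).

Definition csummable u :=
  abs_summable (fun x => complex.Re (u x)) /\ abs_summable (fun x => complex.Im (u x)).

Definition csum u : R[i] :=
  Complex (summation (fun x => complex.Re (u x))) (summation (fun x => complex.Im (u x))).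

Lemma csum_linear a u v : csummable u -> csummable v ->
  csum (fun x => a * u x + v x) = a * csum u + csum v.
Proof.
case: a => a b [ru iu] [rv iv]; rewrite /csum.
have -> : (fun x => complex.Re (Complex a b * u x + v x)) =
    (fun x => a * complex.Re (u x)) \+ (fun x => - b * complex.Im (u x)) \+
    (fun x => complex.Re (v x)).
  by apply/funext => x /=; case: (u x) (v x) => [? ?] [? ?] /=; ring.
have -> : (fun x => complex.Im (Complex a b * u x + v x)) =
    (fun x => a * complex.Im (u x)) \+ (fun x => b * complex.Re (u x)) \+
    (fun x => complex.Im (v x)).
  by apply/funext => x /=; case: (u x) (v x) => [? ?] [? ?] /=; ring.
have sZ := @abs_summableZ R X.
rewrite summationD//; last exact: abs_summableD (sZ _ _ ru) (sZ _ _ iu).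
rewrite summationD ?summationZ//; [|exact: sZ..].
rewrite summationD//; last exact: abs_summableD (sZ _ _ iu) (sZ _ _ ru).
rewrite summationD ?summationZ//; [|exact: sZ..].
by apply/eqP; rewrite eq_complex /=; apply/andP; split; apply/eqP; ring.
Qed.

Lemma csum_conj u : csummable u -> csum (fun x => (u x)^*) = (csum u)^*.
Proof.
move=> [ru iu]; rewrite /csum.
have -> : (fun x => complex.Re (u x)^*) = (fun x => complex.Re (u x)).
  by apply/funext => x; case: (u x).
have -> : (fun x => complex.Im (u x)^*) = (fun x => -1 * complex.Im (u x)).
  by apply/funext => x; case: (u x) => a b /=; rewrite mulN1r.
by rewrite summationZ// mulN1r.
Qed.

Lemma csum_fset u (A : {fset X}) : (forall x, x \notin A -> u x = 0) ->
  csum u = \sum_(x <- A) u x.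
Proof.
move=> uA; rewrite /csum !(@summation_fset _ _ _ A); try by move=> x /uA ->.
rewrite /psum; elim/big_rec3 : _ => // x r i c _ <-.
by case: (u x) => [a b].
Qed.

Lemma csum_reindex u (f g : X -> X) : cancel f g -> cancel g f ->
  csum (fun x => u (f x)) = csum u.
Proof.
move=> fK gK; rewrite /csum; congr Complex.
  exact: (summation_reindex (fun x => complex.Re (u x)) fK gK).
exact: (summation_reindex (fun x => complex.Im (u x)) fK gK).
Qed.

(** The squared modulus as a real number, which keeps suprema and summability in [R]. *)
Definition nsq (z : R[i]) : R := complex.Re z ^+ 2 + complex.Im z ^+ 2.

Lemma nsqE z : (nsq z)%:C%C = z * z^*.
Proof.
case: z => a b; rewrite /nsq /=; apply/eqP; rewrite eq_complex /=.
by apply/andP; split; apply/eqP; ring.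
Qed.

Lemma nsq_ge0 z : 0 <= nsq z. Proof. by rewrite addr_ge0// sqr_ge0. Qed.

Lemma nsq_eq0 z : nsq z = 0 -> z = 0.
Proof.
case: z => a b /eqP; rewrite /nsq /= paddr_eq0 ?sqr_ge0// !sqrf_eq0.
by move=> /andP[/eqP-> /eqP->].
Qed.

Lemma nsqM z w : nsq (z * w) = nsq z * nsq w.
Proof. by case: z w => a b [c d]; rewrite /nsq /=; ring. Qed.

Lemma nsqD z w : nsq (z + w) <= 2 * nsq z + 2 * nsq w.
Proof.
case: z w => a b [c d]; rewrite /nsq /=.
by have := sqr_ge0 (a - c); have := sqr_ge0 (b - d); nra.
Qed.

Definition l2_pred : {pred X -> R[i]} :=
  fun f => `[< abs_summable (fun x => nsq (f x)) >].

Lemma l2_predP f : f \in l2_pred <-> exists M, forall A, psum (fun x => nsq (f x)) A <= M.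
Proof.
have e : (fun x => `|nsq (f x)|) = (fun x => nsq (f x)).
  by apply/funext => x; rewrite ger0_norm// nsq_ge0.
by split => [/asboolP[M fM]|[M fM]]; [|apply/asboolP]; exists M => A; move: (fM A); rewrite e.
Qed.

Lemma l2_submod_closed : submod_closed l2_pred.
Proof.
split.
  apply/l2_predP; exists 0 => A; rewrite /psum big1// => x _.
  by rewrite /nsq /= expr0n addr0.
move=> a f g /asboolP sf /asboolP sg; apply/asboolP.
apply: (abs_summable_le _ (abs_summableD (abs_summableZ (2 * nsq a) sf)
  (abs_summableZ 2 sg))) => x /=.
rewrite ger0_norm ?nsq_ge0//.
by apply: le_trans (nsqD _ _) _; rewrite nsqM mulrA.
Qed.

HB.instance Definition _ := GRing.isSubmodClosed.Build R[i] (X -> R[i]) l2_pred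
  l2_submod_closed.

End complex_sum.

(** * The Hilbert space of square-summable functions *)

Section l2.
Variables (R : realType) (X : choiceType).

Record l2 := L2 { l2_fun :> X -> R[i]; l2_funP : l2_fun \in @l2_pred R X }.

HB.instance Definition _ := [isSub for l2_fun].
HB.instance Definition _ := gen_eqMixin l2.
HB.instance Definition _ := gen_choiceMixin l2.
HB.instance Definition _ := [SubChoice_isSubLmodule of l2 by <:].

Implicit Types (f g h : l2) (a : R[i]).

Lemma l2_eq f g : f =1 g -> f = g.
Proof. by move=> fg; apply: val_inj; exact/funext. Qed.

Lemma l2D f g x : (f + g) x = f x + g x. Proof. by []. Qed.
Lemma l2Z a f x : (a *: f) x = a * f x. Proof. by []. Qed.
Lemma l2B f g x : (f - g) x = f x - g x. Proof. by []. Qed.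

Definition l2dot f g : R[i] := csum (fun x => f x * (g x)^*).

Lemma csummable_dot f g : csummable (fun x => f x * (g x)^*).
Proof.
have /asboolP sf := l2_funP f; have /asboolP sg := l2_funP g.
have s := abs_summableD sf sg.
split; apply: abs_summable_le s => x /=;
  case: (f x) (g x) => [a b] [c d]; rewrite /nsq /= ler_norml;
  have := sqr_ge0 (a - c); have := sqr_ge0 (b - d);
  have := sqr_ge0 (a + c); have := sqr_ge0 (b + d);
  have := sqr_ge0 (a - d); have := sqr_ge0 (b - c);
  have := sqr_ge0 (a + d); have := sqr_ge0 (b + c); nra.
Qed.

Lemma l2dotC f g : l2dot f g = (l2dot g f)^*.
Proof.
rewrite -csum_conj; last exact: csummable_dot.
by congr csum; apply/funext => x; rewrite rmorphM /= conjCK mulrC.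
Qed.

Lemma l2dot_linear a f g h : l2dot (a *: f + g) h = a * l2dot f h + l2dot g h.
Proof.
rewrite -csum_linear; [|exact: csummable_dot..].
by congr csum; apply/funext => x; rewrite l2D l2Z mulrDl mulrA.
Qed.

Lemma l2dot_linearr f a g h : l2dot f (a *: g + h) = a^* * l2dot f g + l2dot f h.
Proof. by rewrite l2dotC l2dot_linear rmorphD rmorphM /= -!l2dotC. Qed.

Lemma l2dot_bilinear : bilinear_for
  (GRing.Scale.Law.clone _ _ ( *%R ) _) (GRing.Scale.Law.clone _ _ (Num.conj \; *%R ) _) l2dot.
Proof.
by split => [g a f h|f a g h]; [exact: l2dot_linear|exact: l2dot_linearr].
Qed.

HB.instance Definition _ := bilinear_isBilinear.Build R[i] l2 l2 R[i]
  _ _ l2dot l2dot_bilinear.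

Lemma l2dot_hermitian f g : l2dot f g = (-1) ^+ false * (l2dot g f)^*.
Proof. by rewrite mul1r; exact: l2dotC. Qed.

HB.instance Definition _ := isHermitianSesquilinear.Build R[i] l2 false Num.conj
  l2dot l2dot_hermitian.

Lemma l2dotxx f : l2dot f f = (summation (fun x => nsq (f x)))%:C%C.
Proof.
rewrite /l2dot /csum.
have -> : (fun x => complex.Re (f x * (f x)^*)) = (fun x => nsq (f x)).
  by apply/funext => x; rewrite -nsqE.
rewrite (_ : (fun x => complex.Im (f x * (f x)^*)) = (fun x => 0)).
  by rewrite (@summation_fset _ _ (fun=> 0) fset0)// /psum big1.
by apply/funext => x; rewrite -nsqE.
Qed.

Lemma l2_sum_le f A : psum (fun x => nsq (f x)) A <= summation (fun x => nsq (f x)).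
Proof. by apply: psum_le_summation => [x|]; [exact: nsq_ge0|exact/asboolP/l2_funP]. Qed.

Lemma nsq_le_summation f x : nsq (f x) <= summation (fun x => nsq (f x)).
Proof. by apply: le_trans (l2_sum_le f [fset x]%fset); rewrite /psum big_seq_fset1. Qed.

Lemma l2dot_gt0 f : f != 0 -> 0 < l2dot f f.
Proof.
move=> f0; rewrite l2dotxx ltcR lt_neqAle.
have s0 : 0 <= summation (fun x => nsq (f x)).
  by apply: le_trans (l2_sum_le f fset0); rewrite /psum big_seq_fset0.
rewrite s0 andbT; apply: contra f0 => /eqP e; apply/eqP/l2_eq => x.
by apply/nsq_eq0/le_anti; rewrite nsq_ge0 andbT e nsq_le_summation.
Qed.

HB.instance Definition _ := isDotProduct.Build R[i] l2 l2dot l2dot_gt0.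

End l2.

Section cauchy_schwarz.
Variables (C : numClosedFieldType) (U : lmodType C) (form : {dot U for (@Num.conj C)}).

Lemma dot_cauchy_schwarz u v : `|form u v| ^+ 2 <= form u u * form v v.
Proof.
have [->|v0] := eqVneq v 0; first by rewrite !linear0r normr0 expr0n.
have vv : 0 < form v v by rewrite dnorm_gt0.
(* This vector is [form v v] times the component of [u] orthogonal to [v]; its squared norm is
   [form v v] times the desired difference. *)
have := dnorm_ge0 form (form v v *: u - form u v *: v).
rewrite dnormB !dnormZ.
rewrite [form (form v v *: u) _]linearZl_LR /= linearZr_LR /=.
rewrite (ger0_norm (ltW vv)) -!normCKC geC0_conj; last first.
  by apply: mulr_ge0; [exact: ltW|exact: exprn_ge0].
set a := form v v in vv *; set b := form u u; set d := form u v.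
rewrite (_ : _ - _ = a * (b * a - `|d| ^+ 2)); last by ring.
by rewrite pmulr_rge0// subr_ge0.
Qed.

Lemma dot_sqrt_triangle u v :
  sqrtC (form (u + v) (u + v)) <= sqrtC (form u u) + sqrtC (form v v).
Proof.
rewrite -ler_sqr ?nnegrE ?addr_ge0 ?sqrtC_ge0//.
rewrite sqrrD !sqrtCK addrAC dnormD lerD2l.
rewrite -mulr_natr -[_ + _](divfK (negbT (pnatr_eq0 C 2))) -/('Re _).
rewrite ler_pM2r ?ltr0n//.
rewrite -ReE; apply: le_trans (leif_Re_Creal _).1 _.
rewrite -ler_sqr ?nnegrE ?mulr_ge0 ?sqrtC_ge0// exprMn !sqrtCK.
exact: dot_cauchy_schwarz.
Qed.

End cauchy_schwarz.

Section l2_norm.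
Variables (R : realType) (X : choiceType).
Local Notation H := (l2 R X).
Implicit Types (f g h : H).

Definition l2norm f : R[i] := sqrtC (l2dot f f).

Lemma l2normD f g : l2norm (f + g) <= l2norm f + l2norm g.
Proof. exact: (dot_sqrt_triangle (@l2dot R X)). Qed.

Lemma l2normZ a f : l2norm (a *: f) = `|a| * l2norm f.
Proof.
by rewrite /l2norm (dnormZ (@l2dot R X)) sqrtCM ?nnegrE ?exprn_ge0// sqrCK.
Qed.

Lemma l2norm_eq0 f : l2norm f = 0 -> f = 0.
Proof. by move/eqP; rewrite sqrtC_eq0 (dnorm_eq0 (@l2dot R X)) => /eqP. Qed.

HB.instance Definition _ := Lmodule_isNormed.Build R[i] H l2normD l2normZ l2norm_eq0.

Lemma l2_normE f : `|f| ^+ 2 = (summation (fun x => nsq (f x)))%:C%C.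
Proof. by rewrite -l2dotxx; exact: sqrtCK. Qed.

Lemma gt0_complexP (e : R[i]) : 0 < e -> exists2 r : R, 0 < r & e = r%:C%C.
Proof.
move=> e0; exists (complex.Re e); last by rewrite RRe_real// gtr0_real.
by move: e0; rewrite ltcE => /andP[].
Qed.

Lemma l2_norm_leP f (r : R) : 0 <= r ->
  `|f| <= r%:C%C <-> forall A, psum (fun x => nsq (f x)) A <= r ^+ 2.
Proof.
move=> r0; rewrite -ler_sqr ?nnegrE ?ler0c// l2_normE -rmorphXn lecR.
split => [fr A|fr]; first exact: le_trans (l2_sum_le f A) fr.
by apply: summation_le => //; exact/asboolP/l2_funP.
Qed.

(** Coordinates are bounded by the norm, so a Cauchy filter converges pointwise. Bounds on finite
    partial sums survive this limit, which gives both membership in [l2] and convergence in norm. *)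
Lemma l2_complete (F : set_system H) : ProperFilter F -> cauchy F -> cvg F.
Proof.
move=> FF Fc.
have small (r : R) : 0 < r -> exists2 P, F P & forall g h, P g -> P h ->
    forall A, psum (fun x => nsq (g x - h x)) A <= r ^+ 2.
  move=> r0; have rC : 0 < r%:C%C :> R[i] by rewrite ltcR.
  have [[P Q] [FP FQ] PQ] := (cauchy_ballP F).2 Fc _ rC.
  exists (P `&` Q); first exact: filterI.
  move=> g h [Pg _] [_ Qh]; have := PQ (g, h) (conj Pg Qh).
  by rewrite -ball_normE /= => /ltW /l2_norm_leP; apply; exact: ltW.
pose re x g := complex.Re ((g : H) x); pose im x g := complex.Im ((g : H) x).
have cau (p : R[i] -> R) x : (forall z w, p (z - w) = p z - p w) ->
    (forall z, p z ^+ 2 <= nsq z) -> cvg ((fun g : H => p (g x)) @ F).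
  move=> pB pn; apply: cauchy_cvg; apply/cauchy_ballP => e e0.
  have [P FP PP] := small (e / 2) (divr_gt0 e0 (ltr0Sn _ _)).
  exists ((fun g : H => p (g x)) @` P, (fun g : H => p (g x)) @` P).
    have FP' : F ((fun g : H => p (g x)) @^-1` ((fun g : H => p (g x)) @` P)).
      by apply: filterS FP => g Pg; exists g.
    by split; exact: FP'.
  move=> [_ _] [/= [g Pg <-] [h Ph <-]]; rewrite /ball /= -pB.
  have := PP g h Pg Ph [fset x]%fset; rewrite /psum big_seq_fset1.
  move/(le_trans (pn _)) => q; apply: (@le_lt_trans _ _ (e / 2)); last by lra.
  have e2 : 0 <= e / 2 by lra.
  by rewrite -ler_sqr ?nnegrE// real_normK// num_real.
have cre x : cvg (re x @ F).
  by apply: cau => [[a b] [c d]|[a b]] //; rewrite /nsq lerDl sqr_ge0.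
have cim x : cvg (im x @ F).
  by apply: cau => [[a b] [c d]|[a b]] //; rewrite /nsq lerDr sqr_ge0.
pose f x : R[i] := Complex (lim (re x @ F)) (lim (im x @ F)).
have lims (g : H) A : (fun h : H => psum (fun x => nsq (g x - h x)) A) @ F -->
    psum (fun x => nsq ((g : H) x - f x)) A.
  rewrite /psum; elim: (enum_fset A) => [|x s IH].
    rewrite big_nil; apply: cvg_near_cst; near=> h; by rewrite big_nil.
  rewrite big_cons; under eq_fun do rewrite big_cons.
  apply: cvgD => //.
  have e1 : (fun h : H => nsq (g x - h x)) =1 (fun h : H =>
      (complex.Re (g x) - re x h) * (complex.Re (g x) - re x h) +
      (complex.Im (g x) - im x h) * (complex.Im (g x) - im x h)).
    move=> h; rewrite /nsq /re /im.
    by case: (g x) (h x) => [a b] [c d]; rewrite !expr2.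
  rewrite (eq_cvg _ _ e1).
  have -> : nsq (g x - f x) =
      (complex.Re (g x) - lim (re x @ F)) * (complex.Re (g x) - lim (re x @ F)) +
      (complex.Im (g x) - lim (im x @ F)) * (complex.Im (g x) - lim (im x @ F)).
    by rewrite /nsq /f; case: (g x) => [a b]; rewrite !expr2.
  have c1 : (complex.Re (g x) - re x h) @[h --> F] --> complex.Re (g x) - lim (re x @ F).
    by apply: cvgB (cre x); exact: cvg_cst.
  have c2 : (complex.Im (g x) - im x h) @[h --> F] --> complex.Im (g x) - lim (im x @ F).
    by apply: cvgB (cim x); exact: cvg_cst.
  by apply: cvgD; exact: cvgM.
have close r : 0 < r -> exists2 P, F P & forall g, P g ->
    forall A, psum (fun x => nsq ((g : H) x - f x)) A <= r ^+ 2.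
  move=> r0; have [P FP PP] := small r r0; exists P => // g Pg A.
  rewrite -(cvg_lim _ (lims g A))//; apply: limr_le.
    by apply/cvg_ex; eexists; exact: lims.
  by apply: filterS FP => h Ph; exact: (PP g h Pg Ph A).
have fl : f \in @l2_pred R X.
  have [P FP PP] := close 1 ltr01; have [g Pg] := filter_ex FP.
  have -> : f = (g : X -> R[i]) - ((g : X -> R[i]) - f).
    by rewrite opprB addrC subrK.
  apply: rpredB; first exact: l2_funP.
  by apply/l2_predP; exists (1 ^+ 2) => A; exact: PP.
apply/cvg_ex; exists (L2 fl); apply/cvgrPdist_le => _ /gt0_complexP[r r0 ->].
have [P FP PP] := close r r0; apply: filterS FP => g Pg.
by rewrite distrC; apply/(l2_norm_leP _ (ltW r0)) => A; exact: PP.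
Unshelve. all: by end_near. Qed.

HB.instance Definition _ := Uniform_isComplete.Build H l2_complete.

HB.instance Definition _ := isHilbert.Build R H
  (fun f : H => esym (sqrtCK (l2dot f f))).

End l2_norm.

(** * Operators permuting the basis *)

Lemma lipschitz_bounded_operator (R : realType) (H : hilbertType R) (T : H -> H) (M : R[i]) :
  linear T -> (forall x, `|T x| <= M * `|x|) -> bounded_operator T.
Proof.
move=> lT TM; split => // x; apply/cvgrPdist_lt => e e0.
(* Adding 1 makes the divisor positive even if [M] vanishes. *)
have M1 : 0 < `|M| + 1 by rewrite ltr_wpDl.
have e1 : 0 < e / (`|M| + 1) by rewrite divr_gt0.
near=> y.
have TB : T x - T y = T (x - y).
  by have := lT (-1) y x; rewrite !scaleN1r => h; rewrite [x - y]addrC h addrC.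
have M0 : M * `|x - y| <= `|M| * `|x - y|.
  have [->|xy] := eqVneq (x - y) 0; first by rewrite normr0 !mulr0.
  rewrite ler_pM2r ?normr_gt0//; apply/real_ler_norm/ger0_real.
  have := le_trans (normr_ge0 _) (TM (x - y)).
  by rewrite pmulr_lge0 ?normr_gt0.
rewrite TB; apply: le_lt_trans (TM _) _; apply: le_lt_trans M0 _.
apply: (@le_lt_trans _ _ ((`|M| + 1) * `|x - y|)).
  by rewrite ler_wpM2r// lerDl.
rewrite mulrC -(ltr_pdivlMr _ _ M1).
by near: y; apply: cvgr_dist_lt.
Unshelve. all: by end_near. Qed.

Section l2_delta.
Variables (R : realType) (X : choiceType).
Local Notation H := (l2 R X).
Implicit Types (f g : H) (x y : X).

Lemma delta_l2 x : (fun y => (y == x)%:R) \in @l2_pred R X.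
Proof.
apply/l2_predP; exists 1 => A; rewrite /psum (bigID (pred1 x))/= [X in _ + X]big1 ?addr0.
  rewrite (eq_bigr (fun=> 1)) => [|y /eqP->]; last by rewrite eqxx /nsq /= expr0n expr1n addr0.
  rewrite -big_filter; have [xA|xA] := boolP (x \in A).
    by rewrite filter_pred1_uniq ?fset_uniq// big_seq1.
  by rewrite (eq_in_filter (a2 := pred0)) ?filter_pred0 ?big_nil// => y yA; apply: contraNF xA => /eqP <-.
by move=> y /negPf->; rewrite /nsq /= expr0n addr0.
Qed.

Definition delta x : H := L2 (delta_l2 x).

Lemma hdot_delta f x : hdot f (delta x) = f x.
Proof.
rewrite [LHS](@csum_fset _ _ _ [fset x]%fset).
  by rewrite big_seq_fset1 /= eqxx rmorph1 mulr1.
by move=> y; rewrite inE /= => /negPf->; rewrite rmorph0 mulr0.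
Qed.

Lemma delta_dot x y : hdot (delta x) (delta y) = (x == y)%:R.
Proof. by rewrite hdot_delta /= eq_sym. Qed.

(** Duplicate-free sequences bound the size of the fibres without presupposing that they are
    finite. *)
Definition fiber_le (D : pred X) (phi : X -> X) (c : nat) :=
  forall (s : seq X) y, uniq s -> (forall x, x \in s -> D x /\ phi x = y) -> (size s <= c)%N.

(** Composition with [phi], extended by zero off [D]. This covers translations, truncations to a
    finite set and the lifting of functions from cosets of a group to cosets of a subgroup. *)
Definition pull_fun (D : pred X) (phi : X -> X) f x : R[i] := if D x then f (phi x) else 0.

(** Group the points of [A] by their value under [phi]; each value is taken at most [c] times. *)
Lemma psum_pull D phi c (u : X -> R) A : (forall x, 0 <= u x) -> fiber_le D phi c ->
  psum (fun x => if D x then u (phi x) else 0) A <= c%:R * psum u (phi @` A)%fset.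
Proof.
move=> u0 fib; rewrite /psum mulr_sumr -big_mkcond/=.
rewrite big_seq_cond (eq_bigr (fun x => \sum_(y <- (phi @` A)%fset) if phi x == y then u y else 0)).
  rewrite exchange_big /= big_seq [leRHS]big_seq; apply: ler_sum => y _.
  rewrite -big_mkcondr /= big_const_seq iter_addr_0 mulr_natl ler_wpMn2l//.
  rewrite -size_filter; apply: (fib _ y); first by rewrite filter_uniq// fset_uniq.
  by move=> x; rewrite mem_filter => /andP[/andP[/andP[_ Dx] /eqP e] _].
move=> x /andP[xA _].
rewrite (big_fsetD1 (phi x))/=; last by apply/imfsetP; exists x.
rewrite eqxx big1_fset ?addr0// => y; rewrite !inE => /andP[/negPf yx _] _.
by rewrite eq_sym yx.
Qed.

Lemma pull_sum_le D phi c f A : fiber_le D phi c ->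
  psum (fun x => nsq (pull_fun D phi f x)) A <= c%:R * summation (fun x => nsq (f x)).
Proof.
move=> fib.
rewrite [leLHS](_ : _ = psum (fun x => if D x then nsq (f (phi x)) else 0) A).
  apply: le_trans (psum_pull A (fun y => nsq_ge0 (f y)) fib) _.
  by rewrite ler_wpM2l// l2_sum_le.
apply: eq_bigr => x _; rewrite /pull_fun; case: (D x) => //.
by rewrite /nsq /= expr0n addr0.
Qed.

Lemma pull_l2 D phi c f : fiber_le D phi c -> pull_fun D phi f \in @l2_pred R X.
Proof.
move=> fib; apply/l2_predP; exists (c%:R * summation (fun x => nsq (f x))) => A.
exact: pull_sum_le.
Qed.

Definition pull D phi c (fib : fiber_le D phi c) f : H := L2 (pull_l2 f fib).

Lemma pull_linear D phi c (fib : fiber_le D phi c) : linear (pull fib).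
Proof.
move=> a f g; apply: l2_eq => x; rewrite l2D l2Z /= /pull_fun.
by case: (D x) => //; rewrite mulr0 addr0.
Qed.

Lemma pull_norm D phi c (fib : fiber_le D phi c) f :
  `|pull fib f| ^+ 2 <= c%:R * `|f| ^+ 2.
Proof.
rewrite !l2_normE -[c%:R](rmorph_nat (real_complex R)) -rmorphM lecR.
apply: summation_le => [|A]; first exact/asboolP/l2_funP.
exact: pull_sum_le.
Qed.

Lemma pull_bounded D phi c (fib : fiber_le D phi c) : bounded_operator (pull fib).
Proof.
apply: (@lipschitz_bounded_operator _ _ _ (sqrtC c%:R)); first exact: pull_linear.
move=> f; have c0 : 0 <= sqrtC c%:R :> R[i] by rewrite sqrtC_ge0 ler0n.
have m0 : 0 <= sqrtC c%:R * `|f| by exact: mulr_ge0.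
rewrite -ler_sqr ?nnegrE//.
by rewrite exprMn (sqrtCK c%:R); exact: pull_norm.
Qed.

Lemma fiber_inj (phi : X -> X) : injective phi -> fiber_le predT phi 1.
Proof.
move=> phii [|x [|x' s]] y //= /andP[+ _] h.
rewrite inE negb_or => /andP[/eqP[]]; apply: phii.
by rewrite (h x _).2 ?(h x' _).2// !inE eqxx ?orbT.
Qed.

End l2_delta.

Section permutation_representation.
Variables (R : realType) (X : choiceType) (G : topologicalGroupType).
Variable act : G -> X -> X.
Hypothesis act1 : act 1%g = id.
Hypothesis actM : forall g h, act (g * h)%g = act g \o act h.
Hypothesis act_cont : forall x g, nbhs g [set h | act h x = act g x].
Local Notation H := (l2 R X).

Lemma actK g : cancel (act g) (act g^-1%g).
Proof. by move=> x; rewrite -[LHS]/((act g^-1%g \o act g) x) -actM mulVg act1. Qed.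

Lemma actVK g : cancel (act g^-1%g) (act g).
Proof. by move=> x; rewrite -[LHS]/((act g \o act g^-1%g) x) -actM mulgV act1. Qed.

Definition perm_op g : H -> H := pull (fiber_inj (can_inj (actVK g))).

Lemma perm_opE g f x : perm_op g f x = f (act g^-1%g x). Proof. by []. Qed.

Lemma perm_op_delta g x : perm_op g (delta R x) = delta R (act g x).
Proof.
apply: l2_eq => y; rewrite perm_opE /=; congr (_%:R); congr nat_of_bool.
by apply/eqP/eqP => [<-|->]; rewrite ?actVK ?actK.
Qed.

Lemma perm_op_unitary g (f h : H) : hdot (perm_op g f) (perm_op g h) = hdot f h.
Proof.
exact: (csum_reindex (fun x => f x * (h x)^*) (actVK g) (actK g)).
Qed.

Lemma perm_op1 : perm_op 1%g = id.
Proof. by apply/funext => f; apply: l2_eq => x; rewrite perm_opE invg1 act1. Qed.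

Lemma perm_opM g h : perm_op (g * h)%g = perm_op g \o perm_op h.
Proof.
by apply/funext => f; apply: l2_eq => x; rewrite perm_opE invgM actM.
Qed.

Lemma l2_tail (f : H) (r : R) : 0 < r -> exists A : {fset X},
  exists2 f' : H, (forall x, f' x = if x \in A then f x else 0) & `|f - f'| <= r%:C%C.
Proof.
move=> r0; have /asboolP sf := l2_funP f.
have [A _ Ar] : \forall A \near (@fsets_filter X),
    summation (fun x => nsq (f x)) - psum (fun x => nsq (f x)) A < r ^+ 2.
  have /cvgrPdist_lt/(_ (r ^+ 2)) := summation_cvg sf.
  have r2 : 0 < r ^+ 2 by rewrite exprn_gt0.
  by move=> /(_ r2); apply: filterS => A /=; apply: le_lt_trans; exact: ler_norm.
have {}Ar := Ar A (fsubset_refl A).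
have fib : fiber_le (mem A) id 1.
  move=> [|x [|x' s]] y //= /andP[+ _] h.
  by rewrite inE negb_or (h x _).2 ?mem_head// (h x' _).2 ?eqxx// !inE eqxx orbT.
exists A, (pull fib f) => //.
apply/(l2_norm_leP _ (ltW r0)) => B.
have -> : (fun x => nsq ((f - pull fib f) x)) = (fun x => if x \in A then 0 else nsq (f x)).
  apply/funext => x; rewrite l2B /= /pull_fun /=.
  by case: (x \in A); rewrite ?subr0// subrr /nsq /= expr0n addr0.
apply: le_trans (ltW Ar); rewrite lerBrDr.
apply: le_trans (l2_sum_le f (A `|` B)%fset).
rewrite /psum (big_fsetID _ (mem A) (A `|` B)%fset)/= [leRHS]addrC; apply: lerD; last first.
  rewrite (_ : [fset x in A `|` B | x \in A]%fset = A)//.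
  by apply/fsetP => x; rewrite !inE /=; case: (x \in A) => //=; rewrite andbF.
rewrite (big_fsetID _ (mem A) B)/= big1_fset ?add0r => [|x].
  rewrite (_ : [fset x in A `|` B | x \notin A]%fset = [fset x in B | x \notin A]%fset).
    rewrite big_seq [leRHS]big_seq; apply: ler_sum => x.
    by rewrite !inE /= => /andP[_ /negPf->].
  by apply/fsetP => x; rewrite !inE /=; case: (x \in A) => //=; rewrite andbF.
by rewrite !inE /= => /andP[_ ->].
Qed.

(** Replace [f] by a finitely supported [f']. Near [g] the action agrees with that of [g] on the
    support, so [f'] has a constant image there, and the error is moved isometrically. *)
Lemma perm_op_cont (f : H) : continuous (fun g => perm_op g f).
Proof.
move=> g; apply/cvgrPdist_le => _ /gt0_complexP[r r0 ->].
have r2 : 0 < r / 2 by lra.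
have [A [f' f'E ff']] := l2_tail f r2.
have nrm h : `|perm_op h (f - f')| = `|f - f'|.
  apply/eqP; rewrite -(@eqrXn2 _ 2)//; apply/eqP.
  by rewrite -!hdot_norm perm_op_unitary.
have split h : perm_op h f = perm_op h f' + perm_op h (f - f').
  by apply: l2_eq => x; rewrite l2D !perm_opE l2B addrC subrK.
have near_g : nbhs g [set h | forall x, x \in A -> act h x = act g x].
  have : nbhs g (\bigcap_(x in [set` A]) [set h | act h x = act g x]).
    by apply: filter_bigI => x _; exact: act_cont.
  by apply: filterS => h hA x xA; exact: hA.
apply: filterS near_g => h hg.
have e : perm_op g f' = perm_op h f'.
  apply: l2_eq => x; rewrite !perm_opE !f'E.
  have [gA|gA] := boolP (act g^-1%g x \in A).
    have hx : act h (act g^-1%g x) = x by rewrite hg// actVK.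
    have -> : act h^-1%g x = act g^-1%g x by rewrite -{1}hx actK.
    by rewrite gA.
  have [hA|//] := boolP (act h^-1%g x \in A).
  have gx : act g (act h^-1%g x) = x by rewrite -hg// actVK.
  by move: gA; rewrite -{1}gx actK hA.
rewrite (split g) (split h) e opprD addrACA subrr add0r.
apply: le_trans (ler_normB _ _) _; rewrite !nrm.
apply: le_trans (lerD ff' ff') _.
by rewrite -rmorphD lecR; lra.
Qed.

Definition perm_rep : unitary_rep G H :=
  UnitaryRep (fun g => pull_linear (fiber_inj (can_inj (actVK g)))) perm_op_unitary
    perm_op1 perm_opM perm_op_cont.

Lemma pull_commutant D phi c (fib : @fiber_le X D phi c) :
  (forall g x, D (act g x) = D x) -> (forall g x, D x -> phi (act g x) = act g (phi x)) ->
  commutant (range perm_rep) (pull fib : H -> H).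
Proof.
move=> Dact phiact; split; first exact: pull_bounded.
move=> _ [g _ <-]; apply/funext => f; apply: l2_eq => x.
rewrite /= /pull_fun /= /pull_fun /= Dact; case: ifP => // Dx.
by rewrite phiact.
Qed.

End permutation_representation.

(** * Abelian projections and finite groups of unitaries *)

(** The Cauchy-Frobenius formula for conjugation: commuting pairs are fixed points and classes are
    orbits. *)
Lemma sum_commuting (F : finGroupType) :
  (\sum_(w : F) \sum_(v : F) (v ^ w == v)%g = #|classes [set: F]%SET| * #|F|)%N.
Proof.
pose J := conjg_action F.
have aF : [acts [set: F]%G, on [set: F]%SET | J].
  rewrite astabsJ; apply/fintype.subsetP => x _; rewrite !inE.
  by apply/fintype.subsetP => y _; rewrite inE.
have := Frobenius_Cauchy aF; rewrite cardsT => <-.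
apply: eq_big => [w|w _]; first by rewrite inE.
rewrite -sum1_card [RHS]big_mkcond /=; apply: eq_bigr => v _.
rewrite !inE /= finset.sub1set inE /=.
by case: eqP.
Qed.

Section hdot_sums.
Variables (R : realType) (H : hilbertType R) (I : finType).
Implicit Types (x y : H) (f g : I -> H).

Lemma hdot_suml f y : hdot (\sum_i f i) y = \sum_i hdot (f i) y.
Proof.
by elim/big_rec2 : _ => [|i a b _ <-]; rewrite ?linear0l// linearDl.
Qed.

Lemma hdot_sumr x g : hdot x (\sum_i g i) = \sum_i hdot x (g i).
Proof. exact: raddf_sum. Qed.

Lemma hdotC x y : hdot x y = (hdot y x)^*.
Proof. by rewrite (hermC (@hdot R H)) /= mul1r. Qed.

Lemma cauchy_schwarz x y : `|hdot x y| ^+ 2 <= hdot x x * hdot y y.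
Proof. exact: dot_cauchy_schwarz. Qed.

Lemma sum_cauchy_schwarz f g : `|\sum_i hdot (f i) (g i)| ^+ 2 <=
  (\sum_i hdot (f i) (f i)) * (\sum_i hdot (g i) (g i)).
Proof.
pose a i := `|f i|; pose b i := `|g i|.
have a0 i : 0 <= a i by exact: normr_ge0.
have b0 i : 0 <= b i by exact: normr_ge0.
have ab : `|\sum_i hdot (f i) (g i)| <= \sum_i a i * b i.
  apply: le_trans (ler_norm_sum _ _ _) _; apply: ler_sum => i _.
  have ab0 : 0 <= a i * b i by exact: mulr_ge0 (a0 i) (b0 i).
  rewrite -ler_sqr ?nnegrE//.
  by rewrite exprMn -!hdot_norm cauchy_schwarz.
have s0 : 0 <= \sum_i a i * b i by apply: sumr_ge0 => i _; exact: mulr_ge0 (a0 i) (b0 i).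
apply: (@le_trans _ _ ((\sum_i a i * b i) ^+ 2)).
  by apply: lerXn2r; rewrite ?nnegrE.
have -> : \sum_i hdot (f i) (f i) = \sum_i a i ^+ 2.
  by apply: eq_bigr => i _; exact: hdot_norm.
have -> : \sum_i hdot (g i) (g i) = \sum_i b i ^+ 2.
  by apply: eq_bigr => i _; exact: hdot_norm.
(* Twice Lagrange's identity: the defect in the real Cauchy-Schwarz inequality is a sum of
   squares. *)
have E : (\sum_i a i ^+ 2) * (\sum_i b i ^+ 2) + (\sum_i a i ^+ 2) * (\sum_i b i ^+ 2)
    - ((\sum_i a i * b i) ^+ 2 + (\sum_i a i * b i) ^+ 2) =
    \sum_i \sum_j (a i * b j - a j * b i) ^+ 2.
  have e1 : (\sum_i a i ^+ 2) * (\sum_i b i ^+ 2) = \sum_i \sum_j a i ^+ 2 * b j ^+ 2.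
    by rewrite mulr_suml; apply: eq_bigr => i _; rewrite mulr_sumr.
  have e2 : (\sum_i a i * b i) ^+ 2 = \sum_i \sum_j (a i * b i) * (a j * b j).
    by rewrite expr2 mulr_suml; apply: eq_bigr => i _; rewrite mulr_sumr.
  rewrite {2}e1 exchange_big e1 e2 /= -!big_split /= -sumrB; apply: eq_bigr => i _.
  rewrite -!big_split /= -sumrB; apply: eq_bigr => j _; ring.
have : 0 <= \sum_i \sum_j (a i * b j - a j * b i) ^+ 2.
  apply: sumr_ge0 => i _; apply: sumr_ge0 => j _; rewrite real_exprn_even_ge0//.
  by apply: realB; apply: realM; exact: ger0_real.
rewrite -E -!mulr2n -mulrnBl pmulrn_lge0// subr_ge0; exact.
Qed.

End hdot_sums.

Section abelian_bound.
Variables (R : realType) (H : hilbertType R) (F : finGroupType).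
Variables (U V : F -> {linear H -> H}) (p : {linear H -> H}) (d : H).
Hypothesis U_unitary : forall u x y, hdot (U u x) (U u y) = hdot x y.
Hypothesis UM : forall u v x, U (u * v)%g x = U u (U v x).
Hypothesis U1 : forall x, U 1%g x = x.
Hypothesis V_unitary : forall u x y, hdot (V u x) (V u y) = hdot x y.
Hypothesis VM : forall u v x, V (u * v)%g x = V u (V v x).
Hypothesis V1 : forall x, V 1%g x = x.
Hypothesis UV : forall u v x, U u (V v x) = V v (U u x).
Hypothesis pp : forall x, p (p x) = p x.
Hypothesis p_sa : forall x y, hdot (p x) y = hdot x (p y).
Hypothesis pV : forall v x, p (V v x) = V v (p x).
Hypothesis p_abelian : forall u v x, p (U u (p (U v (p x)))) = p (U v (p (U u (p x)))).
Hypothesis Vd : forall v, V v d = U v^-1%g d.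
Hypothesis Ud : forall u, hdot (U u d) d = (u == 1%g)%:R.

Local Notation N := (#|F|%:R : R[i]).
Local Notation "[< x , y >]" := (hdot x y).

Lemma N_gt0 : 0 < N.
Proof. by rewrite ltr0n; apply/card_gt0P; exists 1%g. Qed.

Lemma U_adj u x y : [<U u x, y>] = [<x, U u^-1%g y>].
Proof. by rewrite -(U_unitary u^-1%g) -UM mulVg U1. Qed.

Lemma V_adj u x y : [<V u x, y>] = [<x, V u^-1%g y>].
Proof. by rewrite -(V_unitary u^-1%g) -VM mulVg V1. Qed.

Lemma dd : [<d, d>] = 1. Proof. by rewrite -{1}(U1 d) Ud eqxx. Qed.

(** The sum of the conjugates of [p] under [U]; it commutes with every [U v], and with every [V v]
    because [U] and [p] do. *)
Let Q x := \sum_u U u (p (U u^-1%g x)).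

Lemma Q_U v x : Q (U v x) = U v (Q x).
Proof.
rewrite /Q linear_sum (reindex_inj (mulgI v)); apply: eq_bigr => u _ /=.
by rewrite invgM !UM -[U v^-1%g _]UM mulVg U1.
Qed.

Lemma Q_V v x : Q (V v x) = V v (Q x).
Proof. by rewrite /Q linear_sum; apply: eq_bigr => u _; rewrite /= UV pV UV. Qed.

Lemma Q_sa x y : [<Q x, y>] = [<x, Q y>].
Proof.
rewrite /Q hdot_suml hdot_sumr; apply: eq_bigr => u _.
by rewrite U_adj p_sa -[in RHS](U_unitary u^-1%g) -!UM mulVg U1.
Qed.

(* The vector state of d is invariant under conjugation by each [U u], because
   [U u d] is the image of [d] under an operator of the commutant. *)
Lemma Q_average (Z Z' : H -> H) :
  (forall u x, Z (U u x) = U u (Z x)) -> (forall u x, Z (V u x) = V u (Z x)) ->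
  (forall u x, Z' (U u x) = U u (Z' x)) -> (forall u x, Z' (V u x) = V u (Z' x)) ->
  [<Q (Z d), Z' d>] = N * [<p (Z d), Z' d>].
Proof.
move=> ZU ZV Z'U Z'V; rewrite /Q hdot_suml.
rewrite (eq_bigr (fun=> [<p (Z d), Z' d>])) => [|u _].
  by rewrite sumr_const mulr_natl.
by rewrite U_adj -ZU -Z'U -Vd ZV Z'V pV V_unitary.
Qed.

Let t := [<p d, d>].
(* [A] is evaluated twice: as it stands it is a third moment of the averages [Q]
   of [p], hence large; after exchanging [U u] and [U v] by [p_abelian] it is
   a coefficient of the conjugation action [T], hence small. *)
Let A := \sum_u \sum_v [<p (U u (p (U v (p d)))), U (u * v)%g d>].

Lemma tE : t = [<p d, p d>]. Proof. by rewrite /t -[in LHS]pp p_sa. Qed.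

(** Moving unitaries across the inner product gives [<p d, Q (Q d)>]. By [Q_average] and
    self-adjointness, [N] times this is [<Q (Q d), Q d>], which is [N] times [<p (Q d), Q d>]. *)
Lemma AE : A = [<p (Q d), p (Q d)>].
Proof.
have -> : A = [<p d, Q (Q d)>].
  rewrite /A exchange_big /= {1}/Q hdot_sumr.
  rewrite [RHS](reindex_inj invg_inj); apply: eq_bigr => v _ /=.
  rewrite invgK -U_adj -p_sa -Q_U {1}/Q hdot_sumr.
  rewrite [RHS](reindex_inj invg_inj); apply: eq_bigr => u _ /=.
  by rewrite invgK UM p_sa U_adj p_sa.
apply: (mulfI (lt0r_neq0 N_gt0)).
rewrite -(Q_average (Z := id) (Z' := fun x => Q (Q x)))//; last 2 first.
- by move=> u x; rewrite !Q_U.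
- by move=> u x; rewrite !Q_V.
rewrite -Q_sa (Q_average Q_U Q_V Q_U Q_V).
by rewrite -p_sa pp.
Qed.

(** Cauchy-Schwarz twice: [<Q d, d> = N * t] bounds [<Q d, Q d>], hence [<p (Q d), p d>], from
    below; the latter in turn bounds [A]. *)
Lemma A_lower : (N * t ^+ 2) ^+ 2 <= A * t.
Proof.
have Qt : [<Q d, d>] = N * t by exact: (Q_average (Z := id) (Z' := id)).
have QQ : [<Q d, Q d>] = N * [<p (Q d), p d>].
  by rewrite -p_sa pp -Q_sa; exact: (Q_average (Z' := id) Q_U Q_V).
have t0 : 0 <= t by rewrite tE; exact: dnorm_ge0.
have Nt : (N * t) ^+ 2 <= [<Q d, Q d>].
  have := cauchy_schwarz (Q d) d; rewrite Qt dd mulr1.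
  by rewrite ger0_norm// mulr_ge0.
have Nt2 : N * t ^+ 2 <= [<p (Q d), p d>].
  by rewrite -(ler_pM2l N_gt0) -QQ; apply: le_trans Nt; rewrite exprMn mulrA expr2.
have Nt0 : 0 <= N * t ^+ 2 by rewrite mulr_ge0 ?ler0n ?exprn_ge0.
have := cauchy_schwarz (p (Q d)) (p d); rewrite -AE -tE; apply: le_trans.
have PQ0 := le_trans Nt0 Nt2.
by rewrite ger0_norm//; apply: lerXn2r; rewrite ?nnegrE.
Qed.

Lemma p_contract x : [<p x, p x>] <= [<x, x>].
Proof.
have e : [<x, p x>] = [<p x, p x>] by rewrite p_sa pp.
have := dnorm_ge0 (@hdot R H) (x - p x).
rewrite (dnormB (@hdot R H)) e.
by rewrite geC0_conj ?dnorm_ge0// -[X in _ - X]mulr2n opprD addrA addrK subr_ge0.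
Qed.

(** It sends [U u d] to the sum of the [U (v * u * v^-1) d]. Up to the factor [N] it is the
    projection onto the vectors fixed by all [U v \o V v]. *)
Let T x := \sum_v U v (V v x).

Lemma T_sa x y : [<T x, y>] = [<x, T y>].
Proof.
rewrite /T hdot_suml hdot_sumr [RHS](reindex_inj invg_inj); apply: eq_bigr => v _ /=.
by rewrite U_adj V_adj UV.
Qed.

Lemma T_T x : T (T x) = N *: T x.
Proof.
rewrite {1}/T (eq_bigr (fun=> T x)) => [|v _].
  by rewrite sumr_const scaler_nat.
rewrite /T !linear_sum /= [RHS](reindex_inj (mulgI v)); apply: eq_bigr => w _ /=.
by rewrite UM VM -UV.
Qed.

Let B := \sum_u [<T (p (U u d)), p (U u d)>].

(** Exchanging [U u] and [U v] by [p_abelian] turns the sum over [v] into [T]. Cauchy-Schwarz then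
    separates the vectors [p (U u (p d))], of total squared norm at most [N * t], from the
    [T (p (U u d))], of total squared norm [N * B]. *)
Lemma A_upper : `|A| ^+ 2 <= N * t * (N * B).
Proof.
have -> : A = \sum_u [<p (U u (p d)), T (p (U u d))>].
  rewrite /A; apply: eq_bigr => u _; rewrite {1}/T hdot_sumr.
  rewrite [RHS](reindex_inj invg_inj); apply: eq_bigr => v _ /=.
  by rewrite p_abelian p_sa U_adj -pV -UV Vd invgK -UM.
apply: le_trans (sum_cauchy_schwarz _ _) _.
have B0 : 0 <= B.
  apply: sumr_ge0 => u _; rewrite -(pmulr_rge0 _ N_gt0) -linearZl_LR /= -T_T T_sa; exact: dnorm_ge0.
apply: ler_pM.
- by apply: sumr_ge0 => u _; exact: dnorm_ge0.
- by apply: sumr_ge0 => u _; exact: dnorm_ge0.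
- rewrite mulr_natl -sumr_const; apply: ler_sum => u _.
  by apply: le_trans (p_contract _) _; rewrite U_unitary -tE.
- rewrite /B mulr_sumr; apply: ler_sum => u _.
  by rewrite -T_sa T_T linearZl_LR.
Qed.

(** Each [V] is moved past [p] and [U] and traded for some [U] on [d] by [Vd]. Collecting terms by
    [v] exposes sums over conjugacy classes, whose norms [sum_conj_norm] computes. *)
Lemma B_E : B = \sum_v [<\sum_u U (v ^ u)%g d, p (U v (p d))>].
Proof.
rewrite /B /T (eq_bigr (fun u => \sum_v [<U (v ^ u^-1)%g d, p (U v (p d))>])).
  rewrite exchange_big /=; apply: eq_bigr => v _.
  rewrite hdot_suml [RHS](reindex_inj invg_inj); exact: eq_bigr.
move=> u _; rewrite hdot_suml [RHS](reindex_inj invg_inj); apply: eq_bigr => v _.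
have -> : U (v^-1 ^ u^-1)%g d = V u (V v (U u d)).
  by rewrite conjgE invgK !UM -(Vd u) UV UV -(Vd v) UV.
rewrite V_adj -(pV u^-1%g) -(UV v^-1%g u^-1%g) -(pV u^-1%g) (Vd u^-1%g) invgK.
by rewrite -[in RHS]p_sa -U_adj pV.
Qed.

(** As the [U u d] are orthonormal, the inner products count pairs with [v ^ u = v ^ w]; for fixed
    [v] there are [N] times as many as elements commuting with [v]. *)
Lemma sum_conj_norm :
  \sum_v [<\sum_u U (v ^ u)%g d, \sum_u U (v ^ u)%g d>] =
    N ^+ 2 * #|classes [set: F]%SET|%:R.
Proof.
have orth u v : [<U u d, U v d>] = (u == v)%:R.
  by rewrite -(U_unitary v^-1%g) -!UM mulVg U1 Ud -eq_mulVg1 eq_sym.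
have fix_sum v : [<\sum_u U (v ^ u)%g d, \sum_u U (v ^ u)%g d>] =
    N * \sum_w (v ^ w == v)%g%:R.
  rewrite hdot_suml (eq_bigr (fun=> \sum_w (v ^ w == v)%g%:R)) => [|u _].
    by rewrite sumr_const mulr_natl.
  rewrite hdot_sumr (reindex_inj (mulIg u)); apply: eq_bigr => w _ /=.
  by rewrite orth conjgM (inj_eq (can_inj (conjgK u))) eq_sym.
rewrite (eq_bigr _ (fun v _ => fix_sum v)) -mulr_sumr exchange_big /= expr2 -mulrA.
congr (_ * _).
have := sum_commuting F; rewrite mulnC => /(congr1 (fun n => n%:R : R[i])).
rewrite natrM natr_sum => <-; apply: eq_bigr => w _; exact/esym/natr_sum.
Qed.

(* The lower bound [N^2 t^3 <= A], [A^2 <= N^2 t B] and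
   [B^2 <= (N^2 #classes) (N t)] together give [N^8 t^12 <= N^7 t^3 #classes]. *)
Theorem abelian_corner_bound : t ^+ 9 * N <= #|classes [set: F]%SET|%:R.
Proof.
have N0 := N_gt0.
have t0 : 0 <= t by rewrite tE; exact: dnorm_ge0.
have [->|tn0] := eqVneq t 0; first by rewrite expr0n mul0r ler0n.
have {tn0 t0}t0 : 0 < t by rewrite lt_neqAle eq_sym tn0.
have cl0 : 0 <= #|classes [set: F]%SET|%:R :> R[i] by rewrite ler0n.
set cl := #|classes [set: F]%SET|%:R in cl0 *.
have A0 : N ^+ 2 * t ^+ 3 <= A.
  rewrite -(ler_pM2r t0); apply: le_trans A_lower; rewrite le_eqVlt; apply/orP; left.
  by apply/eqP; ring.
have B0 : N ^+ 2 * t ^+ 5 <= B.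
  have c : 0 < N ^+ 2 * t by rewrite mulr_gt0// exprn_gt0.
  rewrite -(ler_pM2l c).
  have -> : N ^+ 2 * t * B = N * t * (N * B) by ring.
  apply: le_trans A_upper.
  have -> : N ^+ 2 * t * (N ^+ 2 * t ^+ 5) = (N ^+ 2 * t ^+ 3) ^+ 2 by ring.
  have c3 : 0 <= N ^+ 2 * t ^+ 3 by rewrite mulr_ge0 ?exprn_ge0 ?ltW.
  by rewrite ger0_norm ?(le_trans c3)//; apply: lerXn2r; rewrite ?nnegrE ?(le_trans c3).
have B1 : B ^+ 2 <= N ^+ 2 * cl * (N * t).
  have c5 : 0 <= N ^+ 2 * t ^+ 5 by rewrite mulr_ge0 ?exprn_ge0 ?ltW.
  rewrite -[B]ger0_norm ?(le_trans c5)// B_E.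
  apply: le_trans (sum_cauchy_schwarz _ _) _; rewrite sum_conj_norm.
  have Nc : 0 <= N ^+ 2 * cl by apply: mulr_ge0 => //; exact/exprn_ge0/ltW.
  apply: ler_wpM2l => //.
  rewrite mulr_natl -sumr_const; apply: ler_sum => u _.
  by apply: le_trans (p_contract _) _; rewrite U_unitary -tE.
have c : 0 < N ^+ 3 * t by rewrite mulr_gt0// exprn_gt0.
rewrite -(ler_pM2l c).
have -> : N ^+ 3 * t * cl = N ^+ 2 * cl * (N * t) by ring.
apply: le_trans B1.
have -> : N ^+ 3 * t * (t ^+ 9 * N) = (N ^+ 2 * t ^+ 5) ^+ 2 by ring.
have c5 : 0 <= N ^+ 2 * t ^+ 5 by rewrite mulr_ge0 ?exprn_ge0 ?ltW.
by apply: lerXn2r; rewrite ?nnegrE ?(le_trans c5).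
Qed.

End abelian_bound.

(** * Conjugacy classes of symmetric groups *)

Section symmetric_group_classes.
Local Open Scope group_scope.

(* The set [B] consists of the products of adjacent transpositions over the
   subsets of [{0, ..., n - 1}]; that the conjugator can be chosen to fix 0
   is what makes the induction work. *)
Lemma perm_normal_form n : exists B : seq 'S_n.+1, (size B <= 2 ^ n)%N /\
  forall v : 'S_n.+1, exists2 s : 'S_n.+1, s ord0 = ord0 & v ^ s \in B.
Proof.
elim: n => [|n [B [sB BP]]].
  exists [:: 1]; split => // v; exists 1; first by rewrite perm1.
  by rewrite inE; apply/eqP/permP => i; rewrite [LHS]ord1 [RHS]ord1.
pose l (s : 'S_n.+1) : 'S_n.+2 := lift_perm ord0 ord0 s.
pose t : 'S_n.+2 := tperm ord0 (lift ord0 ord0).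
have lJ (s u : 'S_n.+1) : l s ^ l u = l (s ^ u).
  by rewrite /l !conjgE lift_permV !lift_permM.
have fixE (w : 'S_n.+2) : w ord0 = ord0 -> exists w', w = l w'.
  move=> w0.
  have inj : injective (fun i : 'I_n.+1 => odflt ord0 (unlift ord0 (w (lift ord0 i)))).
    move=> i j; have ne k : ord0 != w (lift ord0 k).
      by rewrite -[X in X != _]w0 (inj_eq perm_inj) neq_lift.
    case: (unlift_some (ne i)) => i' ei ->; case: (unlift_some (ne j)) => j' ej -> /= e.
    by apply: (@lift_inj _ ord0); apply: (@perm_inj _ w); rewrite ei ej e.
  exists (perm inj); apply/permP => i; rewrite /l.
  case: (unliftP ord0 i) => [j ->|->]; last by rewrite lift_perm_id.
  rewrite lift_perm_lift permE.
  have ne : ord0 != w (lift ord0 j).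
    by rewrite -[X in X != _]w0 (inj_eq perm_inj) neq_lift.
  by case: (unlift_some ne) => i' ei ->.
exists ([seq l b | b <- B] ++ [seq l b * t | b <- B]); split.
  by rewrite size_cat !size_map expnS mul2n -addnn leq_add.
move=> v; have [v0|v0] := eqVneq (v ord0) ord0.
  have [w ->] := fixE v v0; have [s s0 sP] := BP w.
  exists (l s); first by rewrite /l lift_perm_id.
  by rewrite lJ mem_cat map_f.
(* Conjugation by [tau] makes [v] send 0 to 1; multiplying by [t] then gives a permutation fixing 0,
   to which induction applies. *)
pose tau : 'S_n.+2 := tperm (v ord0) (lift ord0 ord0).
have tau0 : tau ord0 = ord0 by rewrite tpermD// neq_lift.
have tau0V : tau^-1 ord0 = ord0 by rewrite -[in LHS]tau0 permK.
have w0 : (v ^ tau * t) ord0 = ord0.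
  by rewrite conjgE !permM tau0V tpermL tpermR.
have [w ew] := fixE _ w0; have [s s0 sP] := BP w.
exists (tau * l s); first by rewrite permM tau0 /l lift_perm_id.
have -> : v ^ (tau * l s) = l (w ^ s) * t.
  rewrite conjgM -[v ^ tau](mulgK t) ew conjMg lJ; congr (_ * _).
  (* Since [s] fixes 0, [l s] fixes both 0 and 1 and so commutes with [t]. *)
  rewrite /t tpermV tpermJ /l lift_perm_id lift_perm_lift s0.
  by [].
by rewrite mem_cat; apply/orP; right; apply/mapP; exists (w ^ s).
Qed.

Lemma card_classes_Sn n : (#|classes [set: 'S_n]%SET| <= 2 ^ n)%N.
Proof.
case: n => [|n].
  apply: leq_trans (leq_imset_card _ _) _.
  by rewrite cardsT card_Sn.
have [B [sB BP]] := perm_normal_form n.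
apply: leq_trans (leq_trans sB _); last by rewrite leq_exp2l.
rewrite -(size_map (fun b => b ^: [set: 'S_n.+1]%SET)); apply: leq_trans (card_size _).
apply: subset_leq_card; apply/fintype.subsetP => _ /imsetP[v _ ->].
have [s _ sP] := BP v; apply/mapP; exists (v ^ s) => //.
by rewrite classGidl// inE.
Qed.

End symmetric_group_classes.

(** * Translation representations *)

Definition linear_map (C : nzRingType) (V W : lmodType C) (T : V -> W) (lT : linear T) :
  {linear V -> W} := HB.pack T (GRing.isLinear.Build C V W _ T lT).

Section translates.
Variable G : topologicalGroupType.
Implicit Types (g h x y : G) (S K L : set G).
Local Open Scope group_scope.

Definition subgroup K := [/\ K 1, forall g h, K g -> K h -> K (g * h) &
  forall g, K g -> K g^-1].

Definition ltrans g S : set G := [set g * h | h in S].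
(** The inverse makes right multiplication a left action. *)
Definition rtrans g S : set G := [set h * g^-1 | h in S].

Lemma ltrans1 : ltrans 1 = id.
Proof.
apply/funext => S; rewrite /ltrans /= -[RHS]image_id; apply: eq_imagel => h _.
exact: mul1g.
Qed.

Lemma ltransM g h : ltrans (g * h) = ltrans g \o ltrans h.
Proof.
apply/funext => S; rewrite /ltrans /= image_comp; apply: eq_imagel => x _ /=.
by rewrite mulgA.
Qed.

Lemma rtrans1 : rtrans 1 = id.
Proof.
apply/funext => S; rewrite /rtrans /= -[RHS]image_id; apply: eq_imagel => h _.
by rewrite invg1 mulg1.
Qed.

Lemma rtransM g h : rtrans (g * h) = rtrans g \o rtrans h.
Proof.
apply/funext => S; rewrite /rtrans /= image_comp; apply: eq_imagel => x _ /=.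
by rewrite invgM mulgA.
Qed.

Lemma lrtrans g h S : ltrans g (rtrans h S) = rtrans h (ltrans g S).
Proof.
rewrite /ltrans /rtrans !image_comp; apply: eq_imagel => x _ /=.
by rewrite mulgA.
Qed.

Lemma ltrans_subgroup K g : subgroup K -> K g -> ltrans g K = K.
Proof.
move=> [K1 KM KV] Kg; apply/seteqP; split => [_ [h Kh <-]|h Kh]; first exact: KM.
by exists (g^-1 * h); [exact/KM/Kh/KV|rewrite mulVKg].
Qed.

Lemma ltrans_eq K g h : subgroup K -> ltrans g K = ltrans h K -> K (g^-1 * h).
Proof.
move=> [K1 KM KV] e; have : ltrans h K h by exists 1; rewrite ?mulg1.
by rewrite -e => -[k Kk <-]; rewrite mulKg.
Qed.

Variable K : nat -> set G.
Hypothesis K_subgroup : forall n, subgroup (K n).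
Hypothesis K_nbhs : forall n, nbhs 1 (K n).

Definition is_translate S := exists n x y, S = ltrans x (rtrans y (K n)).

(* A family of subsets which contains the [K n], and on which left and right
   multiplication both act, the former with open stabilisers. *)
Record translate := Translate { tset :> set G; tsetP : is_translate tset }.
HB.instance Definition _ := gen_eqMixin translate.
HB.instance Definition _ := gen_choiceMixin translate.

Lemma translate_eq (S T : translate) : S = T :> set G -> S = T.
Proof. by case: S T => S Sp [T Tp] /= e; subst T; congr Translate; exact: Prop_irrelevance. Qed.

Lemma ltrans_is_translate g (S : translate) : is_translate (ltrans g S).
Proof.
have [n [x [y e]]] := tsetP S; rewrite e; exists n, (g * x), y.
by rewrite ltransM.
Qed.

Lemma rtrans_is_translate g (S : translate) : is_translate (rtrans g S).
Proof.
have [n [x [y e]]] := tsetP S; rewrite e; exists n, x, (g * y).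
by rewrite rtransM /= -lrtrans.
Qed.

Definition lact g (S : translate) := Translate (ltrans_is_translate g S).
Definition ract g (S : translate) := Translate (rtrans_is_translate g S).

Lemma lact1 : lact 1 = id.
Proof. by apply/funext => S; apply: translate_eq; rewrite /= ltrans1. Qed.
Lemma lactM g h : lact (g * h) = lact g \o lact h.
Proof. by apply/funext => S; apply: translate_eq; rewrite /= ltransM. Qed.
Lemma ract1 : ract 1 = id.
Proof. by apply/funext => S; apply: translate_eq; rewrite /= rtrans1. Qed.
Lemma ractM g h : ract (g * h) = ract g \o ract h.
Proof. by apply/funext => S; apply: translate_eq; rewrite /= rtransM. Qed.
Lemma lract g h (S : translate) : lact g (ract h S) = ract h (lact g S).
Proof. by apply: translate_eq; rewrite /= lrtrans. Qed.

Lemma mulgr_continuous g : continuous (fun h : G => h * g).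
Proof.
move=> h; apply: (@continuous_comp _ _ _ (fun h => (h, g))
  (fun xy : G * G => xy.1 * xy.2)); last exact: mulg_continuous.
by apply: cvg_pair; [exact: cvg_id|exact: cvg_cst].
Qed.

(** The translate [x K_n y^-1] is stabilised by [x K_n x^-1], a neighbourhood of 1. *)
Lemma lact_continuous (S : translate) g : nbhs g [set h | lact h S = lact g S].
Proof.
have [n [x [y e]]] := tsetP S.
have c : {for g, continuous (fun h => x^-1 * g^-1 * h * x)}.
  apply: (@continuous_comp _ _ _ (fun h => x^-1 * g^-1 * h) (fun h => h * x)).
    exact: mulgl_continuous.
  exact: mulgr_continuous.
have nK : nbhs (x^-1 * g^-1 * g * x) (K n) by rewrite mulgVK mulVg.
have {}nK : nbhs g [set h | K n (x^-1 * g^-1 * h * x)] := c _ nK.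
apply: filterS nK => h /= Kh; apply: translate_eq.
rewrite /= e ![ltrans _ (rtrans _ _)]lrtrans.
rewrite -![ltrans _ (ltrans _ _)]/((ltrans _ \o ltrans _) _) -!ltransM.
congr (rtrans y _).
have -> : h * x = g * x * (x^-1 * g^-1 * h * x) by rewrite !mulgA mulgK mulgV mul1g.
by rewrite ltransM /= (ltrans_subgroup (K_subgroup n) Kh).
Qed.

Variable R : realType.
Local Notation H := (l2 R translate).

Definition translation_rep : unitary_rep G H := perm_rep R lact1 lactM lact_continuous.

Local Notation M := (generated_vN (range translation_rep)).
Local Notation lop := (perm_op lact1 lactM (R := R)).
Local Notation rop := (perm_op ract1 ractM (R := R)).

Lemma rop_commutant g : commutant (range translation_rep) (rop g).
Proof.
by apply: pull_commutant => // h S _; rewrite lract.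
Qed.

Lemma rep_generated g : M (translation_rep g).
Proof.
split => [|T [_ TM]]; first exact: pull_bounded.
by rewrite TM//; exists g.
Qed.

Section index_bound.
Variables (p : H -> H) (S L : translate) (I : finType) (c : G -> I).
Hypotheses (Mp : M p) (pP : projection p).
Hypotheses (sS : subgroup S) (sL : subgroup L) (SL : tset S `<=` tset L).
Hypothesis c_inj : forall g h, tset L g -> tset L h -> c g = c h -> tset S (g^-1 * h).

(** [D] selects the left cosets of [S], and [phi] sends [x S] to [x L], whichever representative
    [xget] picks ([phi_lact]). *)
Let D (T : translate) := `[< exists x, T = lact x S >].
Let rep (T : translate) : G := xget 1 [set x | T = lact x S].
Let phi (T : translate) : translate := lact (rep T) L.

Lemma repP T : D T -> T = lact (rep T) S.
Proof. by move=> /asboolP DT; exact: (xgetPex 1 DT). Qed.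

Lemma phi_lact x : phi (lact x S) = lact x L.
Proof.
have /repP e : D (lact x S) by apply/asboolP; exists x.
have e' : ltrans x S = ltrans (rep (lact x S)) S by exact: (congr1 tset e).
have xS := SL (ltrans_eq sS e').
have Lx : tset L ((rep (lact x S))^-1 * x).
  by have [_ _ SV] := sL; have := SV _ xS; rewrite invgM invgK.
apply: translate_eq => /=.
by rewrite -[in RHS](mulVKg (rep (lact x S)) x) ltransM /= (ltrans_subgroup sL Lx).
Qed.

(** The cosets [x S] inside one coset [x0 L] are separated by the value of [c] at [x0^-1 x]. *)
Lemma phi_fiber : fiber_le D phi #|I|.
Proof.
move=> [|T0 s] y us sD //.
pose x0 := rep T0.
pose f T := c (x0^-1 * rep T).
have LT T : T \in T0 :: s -> tset L (x0^-1 * rep T).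
  move=> Ts; apply: (ltrans_eq sL); rewrite -[LHS]/(tset (phi T0)) -[RHS]/(tset (phi T)).
  by rewrite (sD _ Ts).2 (sD _ (mem_head _ _)).2.
have fi : {in T0 :: s &, injective f}.
  move=> T T' Ts Ts' /(c_inj (LT _ Ts) (LT _ Ts')).
  rewrite invgM invgK -mulgA mulVKg => ST.
  rewrite (repP (sD _ Ts).1) (repP (sD _ Ts').1); apply: translate_eq => /=.
  have -> : rep T' = rep T * ((rep T)^-1 * rep T') by rewrite mulVKg.
  by rewrite ltransM /= (ltrans_subgroup sS ST).
rewrite -(size_map f) -(card_uniqP _) ?max_card//.
by rewrite map_inj_in_uniq.
Qed.

(* [J f] takes at the coset [x S] the value of [f] at [x L]; it is bounded
   since [L] has at most [#|I|] cosets modulo [S]. *)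
Let J := pull (R := R) phi_fiber.

Lemma J_commutant : commutant (range translation_rep) J.
Proof.
have DL g T : D (lact g T) = D T.
  apply/asboolP/asboolP => [[x e]|[x ->]]; last by exists (g * x); rewrite lactM.
  exists (g^-1 * x); rewrite lactM /= -e -[RHS]/((lact g^-1 \o lact g) T).
  by rewrite -lactM mulVg lact1.
apply: pull_commutant => // g T /repP ->.
rewrite -[lact g (lact _ _)]/((lact g \o lact _) _) -lactM !phi_lact.
by rewrite lactM.
Qed.

Local Open Scope ring_scope.

(** Since [p] commutes with [J], and [J f] at [S] is [f] at [L], pairing [p delta_S] with [J f]
    amounts to pairing [p delta_L] with [f]. Take [f = p delta_L] and apply Cauchy-Schwarz and the
    norm bound on [J]. *)
Lemma index_bound : `|p (delta R L)| ^+ 2 <= #|I|%:R * `|p (delta R S)| ^+ 2 :> R[i].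
Proof.
have [_ pC] := Mp; have [_ _ psa] := pP.
have pJ f : p (J f) = J (p f) by exact: (congr1 (@^~ f) (pC _ J_commutant)).
set n := `|p (delta R L)| ^+ 2; set k := `|p (delta R S)| ^+ 2.
have n0 : 0 <= n by rewrite exprn_ge0.
have [->|nn0] := eqVneq n 0; first by rewrite mulr_ge0 ?ler0n ?exprn_ge0.
have {}n0 : 0 < n by rewrite lt_neqAle eq_sym nn0.
have key f : hdot (p (delta R S)) (J f) = hdot (p (delta R L)) f.
  rewrite !psa pJ hdotC [RHS]hdotC !hdot_delta /= /pull_fun.
  have DS : D S by apply/asboolP; exists 1%g; rewrite lact1.
  have phiS : phi S = L by rewrite -{1}[S]/(id S) -lact1 phi_lact lact1.
  by rewrite DS phiS.
have := cauchy_schwarz (p (delta R S)) (J (p (delta R L))).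
rewrite key !hdot_norm -/n -/k ger0_norm ?(ltW n0)//.
have k0 : 0 <= k by rewrite exprn_ge0.
move=> /le_trans /(_ (ler_wpM2l k0 (pull_norm phi_fiber _))).
by rewrite -/n [k * _]mulrA [n ^+ 2]expr2 (ler_pM2r n0) mulrC.
Qed.

End index_bound.

Section normalizer_bound.
Variables (p : H -> H) (S : translate) (F : finGroupType) (iota : F -> G).
Hypotheses (p_abelian : abelian_projection M p) (sS : subgroup S).
Hypothesis iotaM : forall u v, iota (u * v) = iota u * iota v.
Hypothesis iota_norm : forall u, ltrans (iota u^-1) S = rtrans (iota u) S.
Hypothesis iota_inj : forall u, tset S (iota u) -> u = 1.

Lemma iota1 : iota 1 = 1.
Proof. by apply: (@mulgI _ (iota 1)); rewrite -iotaM !mulg1. Qed.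

Lemma perm_op_linear (act : G -> translate -> translate) (act1 : act 1 = id)
  (actM : forall g h, act (g * h) = act g \o act h) g :
  linear (perm_op act1 actM g : H -> H).
Proof. exact: pull_linear. Qed.

(** Here [U] and [V] are left and right translations by [iota u]. They agree on [delta S] up to
    inversion because [iota u] normalises [S], and [iota_inj] makes the translates of [delta S]
    orthonormal. *)
Lemma normalizer_bound : ((`|p (delta R S)| ^+ 2) ^+ 9 * #|F|%:R <=
  #|classes [set: F]%SET|%:R :> R[i])%R.
Proof.
have [Mp [[lp _] pp psa] pab] := p_abelian.
have pC T : commutant (range translation_rep) T -> forall f, p (T f) = T (p f).
  by case: Mp => _ pC TC f; exact: (congr1 (@^~ f) (pC _ TC)).
pose U u := linear_map (perm_op_linear lact1 lactM (iota u)).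
pose V u := linear_map (perm_op_linear ract1 ractM (iota u)).
have ppE f : p (p f) = p f by exact: (congr1 (@^~ f) pp).
have deltaE : (`|p (delta R S)| ^+ 2 = hdot (p (delta R S)) (delta R S))%R.
  by rewrite -hdot_norm -psa ppE.
rewrite deltaE.
apply: (@abelian_corner_bound R H F U V (linear_map lp) (delta R S)).
- by move=> u x y; exact: perm_op_unitary.
- by move=> u v x; rewrite /U /= iotaM perm_opM.
- by move=> x; rewrite /U /= iota1 perm_op1.
- by move=> u x y; exact: perm_op_unitary.
- by move=> u v x; rewrite /V /= iotaM perm_opM.
- by move=> x; rewrite /V /= iota1 perm_op1.
- move=> u v f; have [_ rC] := rop_commutant (iota v).
  exact/esym/(congr1 (@^~ f) (rC _ (imageT translation_rep (iota u)))).
- exact: ppE.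
- exact: psa.
- by move=> v f; exact: (pC _ (rop_commutant (iota v))).
- move=> u v f; have := congr1 (@^~ f) (pab _ _ (rep_generated (iota u)) (rep_generated (iota v))).
  by rewrite /= !ppE.
- move=> v; rewrite /U /V /= !perm_op_delta; congr delta.
  by apply: translate_eq; rewrite /= iota_norm.
- move=> u; rewrite /U /= perm_op_delta delta_dot; congr (_%:R)%R; congr nat_of_bool.
  apply/eqP/eqP => [e|->]; last by rewrite iota1 lact1.
  apply: iota_inj; rewrite -[iota u]mul1g -invg1; apply: (ltrans_eq sS).
  by rewrite ltrans1 -[RHS]/(tset (lact (iota u) S)) e.
Qed.

End normalizer_bound.

End translates.

(** * A criterion for a group not to be of type I *)

Section not_type_I.
Variables (R : realType) (G : topologicalGroupType) (K : nat -> set G).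
Hypothesis K_subgroup : forall n, subgroup (K n).
Hypothesis K_nbhs : forall n, nbhs 1%g (K n).
Hypothesis K_decr : forall m n, (m <= n)%N -> K n `<=` K m.
(** The codes separate the cosets of [K n] in [K 0], so that [#|I n|] bounds the index. *)
Variables (I : nat -> finType) (c : forall n, G -> I n).
Hypothesis c_inj : forall n g h, K 0%N g -> K 0%N h -> c n g = c n h -> K n (g^-1 * h)%g.
Variables (N : nat -> nat) (emb : forall n, 'S_(N n) -> G).
Hypothesis embM : forall n u v, @emb n (u * v)%g = (@emb n u * @emb n v)%g.
Hypothesis emb_norm : forall n u g,
  K n g -> K n (@emb n u * g * (@emb n u)^-1)%g.
Hypothesis emb_inj : forall n u, K n (@emb n u) -> u = 1%g.
(** The power 9 is that of [t] in [abelian_corner_bound], and [2 ^ N n] bounds the number of classes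
    of ['S_(N n)]. *)
Hypothesis growth : forall (m : nat) (e : R), 0 < e -> exists2 n, (m <= n)%N &
  (#|I n| ^ 9 * 2 ^ N n)%:R < e * (N n)`!%:R.

Let cj x (S : set G) := ltrans x (rtrans x S).

Lemma cjE x S g : cj x S g <-> S (x^-1 * g * x)%g.
Proof.
split => [[_ [h Sh <-] <-]|Sg]; first by rewrite !mulgA mulVg mul1g mulgVK.
by exists (x^-1 * g * x * x^-1)%g; [exists (x^-1 * g * x)%g|rewrite mulgK mulVKg].
Qed.

Lemma subgroup_cj x S : subgroup S -> subgroup (cj x S).
Proof.
move=> [S1 SM SV]; split.
- by apply/cjE; rewrite mulg1 mulVg.
- move=> g h /cjE Sg /cjE Sh; apply/cjE.
  by have := SM _ _ Sg Sh; rewrite !mulgA mulgK.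
- move=> g /cjE Sg; apply/cjE.
  by have := SV _ Sg; rewrite !invgM invgK !mulgA.
Qed.

Theorem not_type_I : ~ type_I_group R G.
Proof.
move=> tI.
pose H := l2 R (translate K); pose pi := translation_rep K_subgroup K_nbhs R.
have bid : bounded_operator (id : H -> H).
  split; first by move=> a f g.
  by move=> f; exact: cvg_id.
(* The identity is a nonzero central projection, so type I provides a nonzero abelian projection. *)
have Mid : generated_vN (range pi) id by split => // T _; apply/funext.
have Cid : commutant (generated_vN (range pi)) id by split => // T _; apply/funext.
have [p [pab p0 _]] : exists p, [/\ abelian_projection (generated_vN (range pi)) p,
    p <> cst 0 & id \o p = p].
  apply: (tI H pi id Mid Cid) => //.
  pose T := Translate (ex_intro _ 0%N (ex_intro _ 1%g (ex_intro _ 1%g erefl))) : translate K.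
  move=> /(congr1 (fun f : H -> H => f (delta R T) T)).
  by rewrite /= eqxx => /eqP; rewrite oner_eq0.
have [Mp pP _] := pab; have [[lp _] pp psa] := pP.
have [T pT] : exists T : translate K, p (delta R T) <> 0.
  apply: contrapT => h; apply: p0; apply/funext => f; apply: l2_eq => T.
  rewrite -hdot_delta psa; have [->|pT] := eqVneq (p (delta R T)) 0.
    by rewrite linear0r.
  by case: h; exists T; apply/eqP.
have [m [x [y eT]]] := tsetP T.
pose cjt n : translate K := Translate (ex_intro _ n (ex_intro _ x (ex_intro _ x erefl))).
have pL : p (delta R (cjt m)) != 0.
  (* A right translation takes [T], that is [x K_m y^-1], to the subgroup [x K_m x^-1]. It is
     isometric and commutes with [p], so [p] does not kill the new basis vector either. *)
  have eL : cjt m = ract (x * y^-1)%g T.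
    apply: translate_eq; rewrite /= eT -lrtrans; congr (ltrans x _).
    by rewrite -[RHS]/((rtrans _ \o rtrans _) _) -rtransM mulgVK.
  have [_ pC] := Mp.
  have rC := rop_commutant K_subgroup K_nbhs R (x * y^-1)%g.
  rewrite eL -(perm_op_delta R (@ract1 G K) (@ractM G K)).
  rewrite (congr1 (@^~ _) (pC _ rC) : p (perm_op _ _ _ _) = _) /=.
  apply/eqP => e; apply: pT.
  have := perm_op_unitary (@ract1 G K) (@ractM G K) (x * y^-1)%g (p (delta R T)) (p (delta R T)).
  rewrite e linear0r => /esym/eqP.
  by rewrite (dnorm_eq0 (@hdot R H)) => /eqP.
have [r r0 rE] : exists2 r : R, 0 < r & `|p (delta R (cjt m))| ^+ 2 = r%:C%C.
  by apply: gt0_complexP; rewrite exprn_gt0// normr_gt0.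
have [n mn ng] := growth m (exprn_gt0 9 r0).
have sS k : subgroup (cjt k) by exact: subgroup_cj.
have SL : tset (cjt n) `<=` tset (cjt m).
  by move=> g /cjE gn; apply/cjE; exact: K_decr mn _ gn.
have cinj g h : tset (cjt m) g -> tset (cjt m) h ->
    c n (x^-1 * g * x)%g = c n (x^-1 * h * x)%g -> tset (cjt n) (g^-1 * h)%g.
  move=> /cjE gm /cjE hm /(c_inj (K_decr (leq0n m) gm) (K_decr (leq0n m) hm)) ghn.
  apply/cjE; move: ghn; rewrite !invgM invgK !mulgA; congr (K n _).
  by rewrite mulgK.
have := index_bound Mp pP (sS n) (sS m) SL cinj; rewrite rE.
pose emb' u := (x * @emb n u * x^-1)%g.
have emb'M u v : emb' (u * v)%g = (emb' u * emb' v)%g.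
  by rewrite /emb' embM !mulgA mulgKV.
have emb'_conj u g : tset (cjt n) g -> tset (cjt n) (emb' u * g * (emb' u)^-1)%g.
  move=> /cjE /(emb_norm u) Kg; apply/cjE; move: Kg; congr (K n _).
  by rewrite /emb' !invgM invgK !mulgA mulgKV mulVg mul1g.
have emb'_inj u : tset (cjt n) (emb' u) -> u = 1%g.
  move=> /cjE un; apply: emb_inj; move: un; congr (K n _).
  by rewrite /emb' !mulgA mulgVK mulVg mul1g.
clearbody emb'.
have emb1 : emb' 1%g = 1%g by apply: (@mulgI _ (emb' 1%g)); rewrite -emb'M !mulg1.
have emb'V u : emb' u^-1%g = (emb' u)^-1%g.
  by apply: (@mulgI _ (emb' u)); rewrite -emb'M !mulgV emb1.
have emb'_norm u : ltrans (emb' u^-1)%g (cjt n) = rtrans (emb' u) (cjt n).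
  apply/seteqP; split => [_ [g gn <-]|_ [g gn <-]].
    exists (emb' u^-1 * g * (emb' u^-1)^-1)%g; first exact: emb'_conj.
    by rewrite emb'V invgK mulgK.
  exists (emb' u * g * (emb' u)^-1)%g; first exact: emb'_conj.
  by rewrite emb'V !mulgA mulVg mul1g.
have := normalizer_bound pab (sS n) emb'M emb'_norm emb'_inj.
have : 0 <= `|p (delta R (cjt n))| ^+ 2 by rewrite exprn_ge0.
move: (_ ^+ 2) => s s0; rewrite card_Sn => sN rs.
have cl : #|classes [set: 'S_(N n)]%SET|%:R <= (2 ^ N n)%:R :> R[i].
  by rewrite ler_nat card_classes_Sn.
have r9 : (r%:C%C) ^+ 9 <= #|I n|%:R ^+ 9 * s ^+ 9 :> R[i].
  rewrite -exprMn; apply: lerXn2r => //; rewrite nnegrE ?ler0c ?(ltW r0)//.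
  by rewrite mulr_ge0.
have fin : (r%:C%C) ^+ 9 * (N n)`!%:R <= #|I n|%:R ^+ 9 * (2 ^ N n)%:R :> R[i].
  apply: le_trans (ler_wpM2r (ler0n _ _) r9) _; rewrite -mulrA.
  by apply: ler_wpM2l; [rewrite exprn_ge0|apply: le_trans sN cl].
move: fin; rewrite -rmorphXn -!natrX -!(rmorph_nat (real_complex R)) -!rmorphM lecR.
by move=> /le_lt_trans /(_ ng); rewrite ltxx.
Qed.

End not_type_I.

(** * Permutations of a level of the tree *)

Section level_permutations.
Variables (d k : nat).
Local Notation V := (vertex d k).
Local Notation N := (neretin d k).
Local Notation Aut := (tree_aut d k).
Local Notation iota := (@neretin_of_aut d k).

(** One step from the root and [n] further letters, hence the vertices of depth [n + 1]. *)
Definition level n : finType := ('I_k * n.-tuple 'I_d)%type.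

(* The vertex reached from the vertex [p] of depth [n + 1] through the letters of
   [r], again read from right to left. *)
Definition graft n (p : level n) (r : seq 'I_d) : V := Some (p.1, r ++ val p.2).

Lemma graft_inj n (p q : level n) r r' : graft p r = graft q r' -> p = q /\ r = r'.
Proof.
case: p q => i s [j t] [-> /= e].
have sz : size r = size r'.
  by have := congr1 size e; rewrite !size_cat !size_tuple => /addIn.
by move/eqP: e; rewrite eqseq_cat// => /andP[/eqP-> /eqP/val_inj->].
Qed.

Lemma depth_graft n (p : level n) r : depth (graft p r) = (size r + n).+1.
Proof. by rewrite /= size_cat size_tuple. Qed.

Lemma graftP n (v : V) : (n < depth v)%N -> exists p r, v = graft (p : level n) r.
Proof.
case: v => [[i s]|//] /= ns.
have sz : size (drop (size s - n) s) == n by rewrite size_drop subKn.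
exists (i, Tuple sz), (take (size s - n) s).
by rewrite /graft /= cat_take_drop.
Qed.

Lemma parent_graft n (p : level n) l r : parent (graft p (l :: r)) = graft p r.
Proof. by []. Qed.

Lemma depth_parent_le (v : V) : (depth (parent v) <= depth v)%N.
Proof. by have [->//|v0] := eqVneq v (root d k); rewrite [leqRHS]depth_parent. Qed.

(** Acts by [s] on the ancestor at depth [n + 1], stored in the last [n] letters of [t], and keeps
    the path below it; [insub] fails exactly when the depth is at most [n]. *)
Definition move n (s : level n -> level n) (v : V) : V :=
  if v is Some (i, t) then
    if insub (drop (size t - n) t) is Some t' then
      graft (s (i, t')) (take (size t - n) t)
    else v
  else v.

Lemma move_graft n s (p : level n) r : move s (graft p r) = graft (s p) r.
Proof.
case: p => i t; rewrite /move /= size_cat size_tuple addnK.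
by rewrite drop_size_cat// take_size_cat// valK.
Qed.

Lemma move_ball n (s : level n -> level n) v : (depth v <= n)%N -> move s v = v.
Proof.
case: v => [[i t]|//] /= tn; rewrite insubF//.
by rewrite size_drop; apply/eqP; lia.
Qed.

Lemma move_comp n (s t : level n -> level n) v : move (s \o t) v = move s (move t v).
Proof.
have [vn|/graftP[p [r ->]]] := leqP (depth v) n; first by rewrite !move_ball.
by rewrite !move_graft.
Qed.

Definition tree_ball n : set V := [set v | depth v <= n]%N.

Lemma ball_subtree n : finite_subtree (tree_ball n).
Proof.
apply/finite_subtreeP; split; [exact: finite_ball|by []|].
by move=> v /=; apply: leq_trans (depth_parent_le v).
Qed.

Lemma not_ball n v : ~ tree_ball n v -> exists p r, v = graft (p : level n) r.
Proof. by move=> /negP; rewrite -ltnNge => /graftP. Qed.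

Lemma graft_not_ball n (p : level n) r : ~ tree_ball n (graft p r).
Proof. by rewrite /tree_ball /mkset depth_graft; lia. Qed.

Section move_bij.
Variables (n : nat) (s t : level n -> level n).
Hypotheses (sK : cancel s t) (tK : cancel t s).

Lemma moveK : cancel (move s) (move t).
Proof.
move=> v; have [vn|/graftP[p [r ->]]] := leqP (depth v) n; first by rewrite !move_ball.
by rewrite !move_graft sK.
Qed.

Lemma move_set_bij : set_bij (~` tree_ball n) (~` tree_ball n) (move s).
Proof.
split.
- by move=> _ /not_ball[p [r ->]]; rewrite move_graft; exact: graft_not_ball.
- by move=> u v _ _; exact: (can_inj moveK).
- move=> _ /not_ball[p [r ->]]; exists (graft (t p) r); first exact: graft_not_ball.
  by rewrite move_graft tK.
Qed.

Lemma move_parent_iso : parent_iso (tree_ball n) (tree_ball n) (move s).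
Proof.
move=> _ /not_ball[p [[|l r] ->]]; [left|right]; rewrite move_graft.
  have h (q : level n) : tree_ball n (parent (graft q [::])).
    have := depth_parent (isT : graft q [::] != root d k).
    by rewrite depth_graft add0n => -[e]; rewrite /tree_ball /mkset -e.
  by split; exact: h.
by rewrite !parent_graft move_graft; split => //; exact: graft_not_ball.
Qed.

(** Edges joining depth [n] to depth [n + 1] need not be preserved, so this is only an almost
    automorphism. *)
Definition move_aa : almost_aut d k :=
  mk_aa (ball_subtree n) (ball_subtree n) move_set_bij move_parent_iso.

End move_bij.

Lemma aut_graft n (a : Aut) (p : level n) : a (graft p [::]) = graft p [::] ->
  forall r, exists r', a (graft p r) = graft p r'.
Proof.
move=> ap; elim=> [|l r [r' e]]; first by exists [::].
have := ta_parent a (graft p (l :: r)); rewrite parent_graft e.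
by case: (a _) => [[i [|l' s]]|]//= [-> ->]; exists (l' :: r').
Qed.

(** Radius [n + 1], so that the roots of the subtrees permuted by [level_move] are fixed. *)
Definition level_fixer n : set N := fixer (tree_ball n.+1).

Lemma level_fixer_subgroup n : subgroup (level_fixer n).
Proof.
split; [|exact: fixer_mul|exact: fixer_inv].
by exists 1%g => //; exact: neretin_of_aut1.
Qed.

Lemma level_fixer_nbhs n : nbhs 1%g (level_fixer n).
Proof.
apply/neretin_nbhs; exists (tree_ball n.+1); first exact: finite_ball.
by move=> _ [h hF <-]; rewrite mul1g.
Qed.

Lemma level_fixer_decr m n : (m <= n)%N -> level_fixer n `<=` level_fixer m.
Proof.
move=> mn _ [a aF <-]; exists a => // v vm; apply: aF.
by apply: leq_trans vm _; rewrite ltnS.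
Qed.

Section embedding.
Variable n : nat.

(* The inverse compensates for the order of composition in ['S_n]. *)
Definition level_perm (u : 'S_(#|level n|)) (p : level n) : level n :=
  enum_val ((u^-1)%g (enum_rank p)).

Lemma level_permM u v : level_perm (u * v)%g =1 level_perm u \o level_perm v.
Proof. by move=> p; rewrite /level_perm /= invMg permM enum_valK. Qed.

Lemma level_perm1 : level_perm 1%g =1 id.
Proof. by move=> p; rewrite /level_perm invg1 perm1 enum_rankK. Qed.

Lemma level_permK u : cancel (level_perm u) (level_perm u^-1%g).
Proof.
by move=> p; rewrite -[LHS]/((level_perm u^-1%g \o level_perm u) p) -level_permM mulVg level_perm1.
Qed.

Lemma level_permVK u : cancel (level_perm u^-1%g) (level_perm u).
Proof.
by move=> p; rewrite -[LHS]/((level_perm u \o level_perm u^-1%g) p) -level_permM mulgV level_perm1.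
Qed.

Definition level_move u : N := neretin_class (move_aa (level_permK u) (level_permVK u)).

Lemma level_moveM u v : level_move (u * v)%g = (level_move u * level_move v)%g.
Proof.
rewrite [RHS]neretin_mulE; apply/neretin_classP/aa_equiv_eq => w /=.
by rewrite -move_comp; congr move; apply/funext => p; rewrite level_permM.
Qed.

Lemma level_moveV u : level_move u^-1%g = (level_move u)^-1%g.
Proof.
have e1 : level_move 1%g = 1%g.
  by apply: (@mulgI _ (level_move 1%g)); rewrite -level_moveM !mulg1.
by apply: (@mulgI _ (level_move u)); rewrite -level_moveM !mulgV.
Qed.

(** An element of the fixer acts inside each subtree hanging at [level n]. Permuting these subtrees
    permutes the actions, so the conjugate [c] is again an automorphism fixing the ball. *)
Lemma level_move_norm u (g : N) : level_fixer n g ->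
  level_fixer n (level_move u * g * (level_move u)^-1)%g.
Proof.
move=> [a aF <-].
pose c v := move (level_perm u) (a (move (level_perm u^-1%g) v)).
have af (p : level n) : a (graft p [::]) = graft p [::].
  by apply: aF; rewrite /tree_ball /mkset depth_graft.
have cb : bijective c.
  apply: bij_comp; first by exists (move (level_perm u^-1%g)); apply: moveK;
    [exact: level_permK|exact: level_permVK].
  apply: bij_comp; first exact: ta_bij.
  by exists (move (level_perm u)); apply: moveK; [exact: level_permVK|exact: level_permK].
have c_ball v : (depth v <= n)%N -> c v = v.
  move=> vn; rewrite /c (move_ball _ vn) aF ?move_ball//.
  exact: leq_trans vn _.
have c_top (p : level n) : c (graft p [::]) = graft p [::].
  by rewrite /c move_graft af move_graft level_permVK.
have c_parent v : parent (c v) = c (parent v).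
  have [vn|/graftP[p [[|l r] ->]]] := leqP (depth v) n.
  - by rewrite !c_ball//; exact: leq_trans (depth_parent_le v) vn.
  - rewrite c_top c_ball//.
    have := depth_parent (isT : graft p [::] != root d k).
    by rewrite depth_graft add0n => -[<-].
  - rewrite parent_graft /c !move_graft.
    set q := level_perm _ p.
    have [r' e] := aut_graft (af q) r; have [r'' e'] := aut_graft (af q) (l :: r).
    have := ta_parent a (graft q (l :: r)); rewrite parent_graft e e' !move_graft.
    case: r'' e' => [|l' r''] e'; last by rewrite !parent_graft => /graft_inj[_ ->].
    (* An empty [r''] would make the parent of [graft q [::]] a vertex of the subtree below it,
       against depths. *)
    move=> e''; have := depth_parent (isT : graft q [::] != root d k).
    by rewrite e'' !depth_graft add0n; lia.
have c0 : c (root d k) = root d k by apply: c_ball.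
exists (mk_ta cb c0 c_parent).
  move=> v /= vn; have [vn'|/graftP[p [[|l r] e]]] := leqP (depth v) n.
  - exact: c_ball.
  - by rewrite e c_top.
  - by move: vn; rewrite e /tree_ball /mkset depth_graft /=; lia.
rewrite -level_moveV; apply/esym.
rewrite [LHS](_ : _ = neretin_class (aa_mul (aa_mul
  (move_aa (level_permK u) (level_permVK u)) (aut_aa a))
  (move_aa (level_permK u^-1%g) (level_permVK u^-1%g)))).
  by apply/neretin_classP/aa_equiv_eq.
by rewrite -!neretin_mulE.
Qed.

Lemma level_move_inj u : (0 < d)%N -> level_fixer n (level_move u) -> u = 1%g.
Proof.
move=> d0 [a aF /neretin_classP[C [[fC _ _] _ aC]]].
have fix_p p : level_perm u p = p.
  (* Equality of classes only gives equality off the finite set [C], which cannot contain the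
     infinite subtree below [p]. *)
  have [r nC] : exists r, ~ C (graft p r).
    apply: contrapT => h; apply: infinite_nat.
    apply: (@sub_finite_set _ _ ((fun v : V => depth v - n.+1)%N @` C)); last first.
      exact: finite_image.
    move=> j _; exists (graft p (nseq j (Ordinal d0))).
      by apply: contrapT => nC; apply: h; exists (nseq j (Ordinal d0)).
    by rewrite depth_graft size_nseq; lia.
  have ap : a (graft p [::]) = graft p [::] by apply: aF; rewrite /tree_ball /mkset depth_graft.
  have [r' e] := aut_graft ap r.
  have : a (graft p r) = move (level_perm u) (graft p r) := aC _ nC.
  by rewrite e move_graft => /graft_inj[].
have uV x : (u^-1)%g x = x.
  by have := fix_p (enum_val x); rewrite /level_perm enum_valK => /enum_val_inj.
by apply: invg_inj; rewrite invg1; apply/permP => x; rewrite uV perm1.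
Qed.

End embedding.

(** * Bounding indices by codes of automorphisms *)

Section code.
Variables (d0 : (0 < d)%N) (n : nat).

(** The default covers the root and its children, which carry no letter of ['I_d]. *)
Definition letter (v : V) : 'I_d := if v is Some (_, l :: _) then l else Ordinal d0.

Lemma letter_eq u v : (1 < depth u)%N -> (1 < depth v)%N ->
  parent u = parent v -> letter u = letter v -> u = v.
Proof. by case: u v => [[i [|l s]]|]// [[i' [|l' s']]|]//= _ _ [-> ->] ->. Qed.

(** The vertices of depth 2 to [n + 1]; those of depth at most 1 are fixed by [level_fixer 0]. *)
Definition code_index : finType := {j : 'I_n & level j.+1}.

(* Recording only the last letter of the image of each vertex yields an index
   exponential in the size of the level, to be beaten by its factorial. *)
Definition code (g : N) : {ffun code_index -> 'I_d} :=
  let a := xget 1%g [set a : Aut | tree_ball 1 `<=` [set v | a v = v] /\ iota a = g] in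
  [ffun x => letter (a (graft (tagged x) [::]))].

(** The image of a vertex is determined by that of its parent and by its last letter, so equal codes
    force agreement on the ball, by induction on depth. *)
Lemma code_inj g h : level_fixer 0 g -> level_fixer 0 h -> code g = code h ->
  level_fixer n (g^-1 * h)%g.
Proof.
have aut_of x : level_fixer 0 x ->
    let a := xget 1%g [set a : Aut | tree_ball 1 `<=` [set v | a v = v] /\ iota a = x] in
    (forall v, tree_ball 1 v -> a v = v) /\ iota a = x.
  move=> [a aF ax].
  have : exists a : Aut, tree_ball 1 `<=` [set v | a v = v] /\ iota a = x by exists a.
  by move=> /(xgetPex 1%g)[].
move=> /aut_of; rewrite /code; set a := xget _ _ => -[aF <-].
move=> /aut_of; set b := xget _ _ => -[bF <-] /ffunP ab.
have {}ab v : tree_ball n.+1 v -> a v = b v.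
  have [m] := ubnP (depth v); elim: m v => // m IH v vm vn.
  have [v1|v1] := leqP (depth v) 1; first by rewrite aF ?bF.
  have v0 : v != root d k by apply/eqP => v0; rewrite v0 in v1.
  have dv := depth_parent v0.
  have pab : a (parent v) = b (parent v).
    by apply: IH; [rewrite -ltnS -dv|rewrite /tree_ball /mkset -ltnS -dv; exact: leqW].
  have lab : letter (a v) = letter (b v).
    have [j jv] : exists j : 'I_n, depth v = j.+2.
      have jn : ((depth v).-2 < n)%N by move: vn; rewrite /tree_ball /mkset; lia.
      by exists (Ordinal jn) => /=; lia.
    have [|p [r e]] := @graftP j.+1 v; first by rewrite jv.
    have r0 : r = [::].
      by apply: size0nil; move: jv; rewrite e depth_graft; lia.
    by have := ab (Tagged (fun j : 'I_n => level j.+1) p); rewrite !ffunE /= -r0 -e.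
  apply: letter_eq lab; rewrite ?ta_depth//.
  by rewrite !ta_parent.
exists (a^-1 * b)%g; last by rewrite neretin_of_autM neretin_of_autV.
by move=> v vn; rewrite ta_mulE -ab// ta_invK.
Qed.

End code.

Lemma card_level n : #|level n| = (k * d ^ n)%N.
Proof. by rewrite card_prod card_tuple !card_ord. Qed.

(** A geometric sum of ratio at least 2 is at most twice its last term. *)
Lemma card_code_index n : (1 < d)%N -> (#|code_index n| <= 2 * #|level n|)%N.
Proof.
move=> d1; rewrite /code_index card_tagged sumnE big_map big_enum /=.
rewrite (eq_bigr (fun j : 'I_n => k * d ^ j.+1)%N) => [|j _]; last exact: card_level.
rewrite card_level; elim: n => [|n IH]; first by rewrite big_ord0.
rewrite big_ord_recr /=; apply: leq_trans (leq_add IH (leqnn _)) _.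
have : (2 * d ^ n <= d ^ n.+1)%N by rewrite expnS leq_mul2r d1 orbT.
by nia.
Qed.

End level_permutations.

(** * Factorials against exponentials, and conclusion *)

Lemma exp_lt_fact (R : realType) (D : nat) (e : R) : 0 < e ->
  exists M, forall n, (M <= n)%N -> (D ^ n)%:R < e * n`!%:R.
Proof.
move=> e0; have /cvgrPdist_lt/(_ _ e0)[M _ h] := cvg_exp_coeff (D%:R : R).
exists M => n Mn; have := h n Mn; rewrite sub0r normrN ger0_norm; last first.
  by rewrite exp_coeff_ge0.
by rewrite /exp_coeff /= ltr_pdivrMr ?ltr0n ?fact_gt0// natrX.
Qed.

Theorem theorem1p5 (R : realType) (d k : nat) (hd : (2 <= d)%N) (hk : (2 <= k)%N) :
  ~ type_I_group R (neretin d k).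
Proof.
have d0 : (0 < d)%N by lia.
apply: (@not_type_I R (neretin d k) (@level_fixer d k) _ _ _ _ (@code d k d0) _
  (fun n => #|level d k n|) (@level_move d k)).
- exact: level_fixer_subgroup.
- exact: level_fixer_nbhs.
- exact: level_fixer_decr.
- exact: code_inj.
- exact: level_moveM.
- exact: level_move_norm.
- by move=> n u; exact: level_move_inj.
(* The index is at most [d] to the power [2 * #|level n|]; its ninth power accounts for [d ^ 18],
   and the conjugacy classes for the factor 2. *)
- move=> m e e0; have [M h] := exp_lt_fact (d ^ 18 * 2) e0.
  have nlt n : (n <= #|level d k n|)%N.
    rewrite card_level; apply: (@leq_trans (d ^ n)); first exact/ltnW/ltn_expl.
    by apply: leq_pmull; lia.
  exists (maxn m M); first exact: leq_maxl.
  set n := maxn m M; apply: le_lt_trans (h _ (leq_trans (leq_maxr m M) (nlt n))).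
  rewrite ler_nat expnMn leq_mul2r card_ffun card_ord -!expnM.
  apply/orP; right; rewrite leq_exp2l// mulnC.
  by have := card_code_index k n hd; lia.
Qed.
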